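(* Let $m\ge1$ be an integer. 1. Assume $p\notin\mathbb{Z}$, and assume that $\underline a$ is chosen so that $\widetilde L_0(\omega^k.\underline a',p)\neq0$ for all $k=0,\dots,m-1$. Then $$\frac{L_0(\underline a',p)}{\widetilde L_0(\underline a',p)}=-i\,\frac{\omega^{-\frac32}\omega^{-(m+1)\frac p2}}{p\sin(\pi p)}\sum_{k=0}^{m-1}\frac{\omega^{r(\omega^k.\underline a)+(k+1)p}}{\widetilde L_0(\omega^k.\underline a',p)\,\widetilde L_0(\omega^{k+1}.\underline a',p)}.$$ 2. Assume $p\in\mathbb{N}^\star$, and assume that $\underline a$ is chosen so that $\widetilde L_0(\omega^k.\underline a',p)\neq0$ for all $k=0,\dots,m-1$. Then $$i\pi p\,\omega^{\frac32+\frac p2}\lambda(\underline a',p)=\sum_{k=0}^{m-1}\frac{\omega^{r(\omega^k.\underline a)+(k+1)p}}{\widetilde L_0(\omega^k.\underline a',p)\,\widetilde L_0(\omega^{k+1}.\underline a',p)}.$$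
   Context: $(\mathfrak{E}_m)$ is the equation $\Phi''(x)=\frac{P_m(x,\underline a)}{x^2}\Phi(x)$, $P_m(x,\underline a)=x^m+a_1x^{m-1}+\cdots+a_m$, $\underline a\in\mathbb{C}^m$; $x$ lies on the universal covering of $\mathbb{C}^\star$. $\omega=e^{2i\pi/m}$, $\omega^c:=e^{2i\pi c/m}$, $\tau.\underline a:=(\tau a_1,\dots,\tau^ma_m)$, $\underline a'=(a_1,\dots,a_{m-1})$, $\tau.\underline a':=(\tau a_1,\dots,\tau^{m-1}a_{m-1})$. Solutions at infinity: define $b_{\frac m2-k}(\underline a)$ by $\frac{\sqrt{P_m(x,\underline a)}}{x}=x^{\frac m2-1}+\sum_{k\ge1}b_{\frac m2-k}(\underline a)x^{\frac m2-k-1}$ at infinity; $r(\underline a)=\frac12-\frac m4$ ($m$ odd), $r(\underline a)=\frac12-\frac m4-b_0(\underline a)$ ($m$ even); $S(x,\underline a)=\frac2mx^{\frac m2}+\sum_{1\le k<m/2}\frac{b_{\frac m2-k}(\underline a)}{\frac m2-k}x^{\frac m2-k}$. $\Phi_0(x,\underline a)$ is the unique solution of $(\mathfrak{E}_m)$ asymptotic at infinity to $x^{r(\underline a)}e^{-S(x,\underline a)}\phi_0$ ($\phi_0$ a formal series in $x^{-1/2}$, resp. $x^{-1}$ for $m$ even, with constant term $1$) in every strict sub-sector of $\{|\arg x|<3\pi/m\}$, locally uniformly in $\underline a$; it extends analytically to the universal covering of $\mathbb{C}^\star$ and is entire in $\underline a$. $\Phi_k(x,\underline a)=\Phi_0(\omega^kx,\omega^k.\underline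 a)$. Solutions at the origin: $p=(1+4a_m)^{1/2}$ (so $a_m=\frac{p^2-1}4$), with $-p\notin\mathbb{N}^\star$, $s(p)=\frac{1+p}2$. $(f_1,f_2)$ is the fundamental system of solutions uniquely determined by $f_1=x^{s(p)}(1+\sum_{k\ge1}A_kx^k)$ and $f_2=\lambda(\underline a',p)f_1\ln x+x^{s(-p)}g_2$ with $g_2$ entire in $x$, where: if $p\notin\mathbb{Z}$, $\lambda=0$ and $g_2(x,\underline a',p)=g_1(x,\underline a',-p)$ with $g_1=x^{-s(p)}f_1$; if $p\in\mathbb{N}^\star$, $g_2=1+\sum_{k\ge1}B_kx^k$ with $B_p=0$; if $p=0$, $\lambda=1$ and $g_2(0)=0$. The coefficients $L_0,\widetilde L_0$ are defined by $\Phi_{-1}(x,\underline a)=L_0(\underline a',p)f_1(x,\underline a',p)+\widetilde L_0(\underline a',p)f_2(x,\underline a',p)$. *)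

(* Defs.v *)
From HB Require Import structures.
From mathcomp Require Import all_boot all_order all_algebra.
From mathcomp Require Import all_classical all_reals all_analysis.
From mathcomp Require Import complex.
Set Implicit Arguments.
Unset Strict Implicit.
Unset Printing Implicit Defensive.
Import Order.TTheory GRing.Theory Num.Theory.
Import numFieldNormedType.Exports.
Local Open Scope classical_set_scope.
Local Open Scope ring_scope.
Local Open Scope complex_scope.

(* The complex field over R, seen only through its numFieldType structure so  *)
(* that it gets its topology and its (complex) derivatives from the generic   *)
(* instances for numFieldType.                                                *)
Definition CC (R : realType) : numFieldType := R[i].

Definition mkC (R : realType) (x y : R) : CC R := x +i* y.
Definition CRe (R : realType) (z : CC R) : R := complex.Re z.
Definition CIm (R : realType) (z : CC R) : R := complex.Im z.
Definition rc (R : realType) (x : R) : CC R := x%:C.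
Definition Ci (R : realType) : CC R := 'i%C.

(* A point of the universal covering of C^* is given by its logarithm t, so   *)
(* that x = cexp t, ln x = t, |x| = e^(Re t), arg x = Im t, and the rotation  *)
(* x |-> omega^k x is the translation of t by 2 i pi k / m.  A function on    *)
(* the covering is a function of t.                                           *)

Definition cexp (R : realType) (z : CC R) : CC R :=
  mkC (expR (CRe z) * cos (CIm z)) (expR (CRe z) * sin (CIm z)).

Definition csin (R : realType) (z : CC R) : CC R :=
  (cexp (Ci R * z) - cexp (- (Ci R * z))) / (2 * Ci R).

(* x^c on the covering *)
Definition cpow (R : realType) (c t : CC R) : CC R := cexp (c * t).

(* derivative with respect to x = cexp t of a function of t *)
Definition dx (R : realType) (F : CC R -> CC R) (t : CC R) : CC R :=
  derive1 F t / cexp t.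

(* a 0 i is a_(i+1) *)
Definition Pm (R : realType) (m : nat) (a : 'rV[CC R]_m) (x : CC R) : CC R :=
  x ^+ m + \sum_(i < m) a 0 i * x ^+ (m - i.+1).

Definition solution (R : realType) (m : nat) (a : 'rV[CC R]_m)
    (F : CC R -> CC R) : Prop :=
  [/\ forall t, derivable F t 1,
      forall t, derivable (dx F) t 1 &
      forall t, dx (dx F) t = Pm a (cexp t) / cexp t ^+ 2 * F t].

(* omega^c = e^(2 i pi c / m) *)
Definition omega (R : realType) (m : nat) (c : CC R) : CC R :=
  cexp (2 * Ci R * rc pi * c / m%:R).

(* tau . a = (tau a_1, tau^2 a_2, ...); used for a and for a' *)
Definition dilate (R : realType) (n : nat) (tau : CC R) (a : 'rV[CC R]_n) :
    'rV[CC R]_n :=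
  \row_(i < n) (tau ^+ i.+1 * a 0 i).

(* c k stands for b_(m/2 - k)(a) when k >= 1, and c 0 = 1 is the coefficient  *)
(* of x^(m/2 - 1); w is the value of the square root of P_m.                  *)
Definition sqrt_expansion (R : realType) (m : nat) (a : 'rV[CC R]_m)
    (c : nat -> CC R) : Prop :=
  c 0%N = 1 /\
  exists rho : R, forall t : CC R, rho < CRe t ->
    exists2 w : CC R, w ^+ 2 = Pm a (cexp t) &
      series (fun k : nat => c k * cpow (m%:R / 2 - k%:R - 1) t) @ \oo
        --> w / cexp t.

(* in rexp and Sexp, b a k stands for b_(m/2 - k)(a) *)
Definition rexp (R : realType) (m : nat) (b : 'rV[CC R]_m -> nat -> CC R)
    (a : 'rV[CC R]_m) : CC R :=
  2^-1 - m%:R / 4 - (if odd m then 0 else b a m./2).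

Definition Sexp (R : realType) (m : nat) (b : 'rV[CC R]_m -> nat -> CC R)
    (a : 'rV[CC R]_m) (t : CC R) : CC R :=
  2 / m%:R * cpow (m%:R / 2) t +
  \sum_(1 <= k < m | (k.*2 < m)%N)
    b a k / (m%:R / 2 - k%:R) * cpow (m%:R / 2 - k%:R) t.

(* phi_0 is a series in x^(-1/2) for m odd and in x^(-1) for m even *)
Definition step (R : realType) (m : nat) : R := if odd m then 2^-1 else 1.

(* Poincare asymptotics of Phi_0, with one remainder bound for all a near a0  *)
Definition asymptotic_at_infinity (R : realType) (m : nat)
    (b : 'rV[CC R]_m -> nat -> CC R)
    (Phi0 : 'rV[CC R]_m -> CC R -> CC R) : Prop :=
  exists q : 'rV[CC R]_m -> nat -> CC R,
    (forall a, q a 0%N = 1) /\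
    forall (a0 : 'rV[CC R]_m) (alpha beta : R) (N : nat),
      - (3 * pi / m%:R) < alpha -> beta < 3 * pi / m%:R ->
      exists K rho : R, \forall a \near a0, forall t : CC R,
        rho < CRe t -> alpha <= CIm t <= beta ->
        `| Phi0 a t / (cpow (rexp b a) t * cexp (- Sexp b a t))
           - \sum_(n < N) q a n * cpow (- (n%:R * rc (step R m))) t |
        <= rc (K * expR (- (N%:R * step R m * CRe t))).

Definition canonical_at_infinity (R : realType) (m : nat)
    (b : 'rV[CC R]_m -> nat -> CC R)
    (Phi0 : 'rV[CC R]_m -> CC R -> CC R) : Prop :=
  [/\ forall a, solution a (Phi0 a),
      asymptotic_at_infinity b Phi0 &
      forall t a, differentiable (fun a : 'rV[CC R]_m => Phi0 a t) a].

Definition Phi (R : realType) (m : nat)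
    (Phi0 : 'rV[CC R]_m -> CC R -> CC R) (k : int)
    (a : 'rV[CC R]_m) (t : CC R) : CC R :=
  Phi0 (dilate (omega m k%:~R) a) (t + 2 * Ci R * rc pi * k%:~R / m%:R).

(* a = (a', a_m) with a_m = (p^2 - 1) / 4 *)
Definition param (R : realType) (m : nat) (a' : 'rV[CC R]_m.-1) (p : CC R) :
    'rV[CC R]_m :=
  \row_(i < m) if insub (i : nat) is Some j then a' 0 (j : 'I_m.-1)
               else (p ^+ 2 - 1) / 4.

Definition is_integer (R : realType) (p : CC R) : Prop :=
  exists z : int, p = z%:~R.

Definition is_pos_natural (R : realType) (p : CC R) : Prop :=
  exists2 n : nat, (0 < n)%N & p = n%:R.

Definition sp (R : realType) (p : CC R) : CC R := (1 + p) / 2.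

Definition entire_with_coefs (R : realType) (g : CC R -> CC R)
    (A : nat -> CC R) : Prop :=
  forall x : CC R, series (fun k : nat => A k * x ^+ k) @ \oo --> g x.

Definition fundamental_system_at_origin (R : realType) (m : nat)
    (f1 f2 : 'rV[CC R]_m.-1 -> CC R -> CC R -> CC R)
    (lambda : 'rV[CC R]_m.-1 -> CC R -> CC R) : Prop :=
  exists g1 g2 : 'rV[CC R]_m.-1 -> CC R -> CC R -> CC R,
  forall (a' : 'rV[CC R]_m.-1) (p : CC R), ~ is_pos_natural (- p) ->
  [/\ solution (param a' p) (f1 a' p) /\ solution (param a' p) (f2 a' p),
      forall t, f1 a' p t = cpow (sp p) t * g1 a' p (cexp t),
      exists2 A, A 0%N = 1 & entire_with_coefs (g1 a' p) A,
      forall t, f2 a' p t =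
        lambda a' p * f1 a' p t * t + cpow (sp (- p)) t * g2 a' p (cexp t) &
      exists2 B, entire_with_coefs (g2 a' p) B &
      [/\ ~ is_integer p ->
            lambda a' p = 0 /\ forall x, g2 a' p x = g1 a' (- p) x,
          forall n : nat, (0 < n)%N -> p = n%:R -> B 0%N = 1 /\ B n = 0 &
          p = 0 -> lambda a' p = 1 /\ B 0%N = 0]].

Definition connection_coefs (R : realType) (m : nat)
    (Phi0 : 'rV[CC R]_m -> CC R -> CC R)
    (f1 f2 : 'rV[CC R]_m.-1 -> CC R -> CC R -> CC R)
    (L0 Lt0 : 'rV[CC R]_m.-1 -> CC R -> CC R) : Prop :=
  forall (a' : 'rV[CC R]_m.-1) (p : CC R), ~ is_pos_natural (- p) ->
  forall t, Phi Phi0 (-1) (param a' p) t =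
            L0 a' p * f1 a' p t + Lt0 a' p * f2 a' p t.

(* Main.v *)
Require Import Defs.
From HB Require Import structures.
From mathcomp Require Import all_boot all_order all_algebra.
From mathcomp Require Import all_classical all_reals all_analysis.
From mathcomp Require Import complex ring lra.

Set Implicit Arguments.
Unset Strict Implicit.
Unset Printing Implicit Defensive.
Import Order.TTheory GRing.Theory Num.Theory.
Import numFieldNormedType.Exports.
Local Open Scope classical_set_scope.
Local Open Scope ring_scope.

(** Everything is read in the variable t = log x, where the rotation
    x |-> omega^c x is a translation and monodromy around 0 is the translation
    by 2 i pi. For k = 0, ..., m let
      V_k(t) = Phi_(-1)(omega^k x, omega^k . a),   x = e^t.
    Rotating x and the parameters together preserves the equation, so all the
    V_k solve the equation with parameter a, and V_k = X_k f1 + Y_k f2 for some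
    constants. They are explicit ([connection_turn]) once it is known how f1
    and f2 behave under a rotation ([f1_turn], [f2_turn]): f1 is multiplied by
    omega^(k s(p)), and f2 by omega^(k s(-p)) after the addition of
    lambda (2 i pi k / m) f1, the trace of its logarithm. In particular
    Y_k = omega^(k s(-p)) Lt_0(omega^k . a', p).

    Now V_(k+1) is Phi_0 rotated by omega^k, so the Wronskian of V_k and V_(k+1)
    is the one of two neighbouring solutions at infinity, one recessive and the
    other dominant on the same ray; its value 2 omega^(k + r(omega^k . a) - 1)
    is read off the leading behaviours ([stokes_wronskian]). On the other hand
    it is (X_k Y_(k+1) - Y_k X_(k+1)) W(f1, f2), and W(f1, f2) = - p is read off
    the leading behaviours at the origin ([wronskian_fundamental]). Dividing by
    p Y_k Y_(k+1) gives X_(k+1) / Y_(k+1) - X_k / Y_k ([coef_ratio_step]), which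
    is the k-th term of the sums to be computed, up to a constant factor.

    The sum over a full turn telescopes ([coef_ratio_telescope]). As
    omega^m = 1,
      X_m / Y_m = e^(2 i pi p) L_0 / Lt_0 + 2 i pi lambda,
    while X_0 / Y_0 = L_0 / Lt_0. If p is not an integer, then lambda = 0 and the
    nonzero factor e^(2 i pi p) - 1 = 2 i e^(i pi p) sin (pi p) can be divided
    out. If p is a positive integer, then e^(2 i pi p) = 1, the two ratios L_0 /
    Lt_0 cancel, and the sum is a multiple of lambda.

    Both Wronskians are constant, but their limits involve derivatives of
    asymptotic relations, about which nothing is assumed. They are obtained from
    the relations themselves by applying to a suitable normalised quotient of
    the two solutions the remark that a convergent function cannot have a
    derivative with a nonzero limit ([scaled_derivative_lim0]). *)

(** * Complex numbers as a field over the reals *)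

Lemma rcD (R : realType) (x y : R) : rc (x + y) = rc x + rc y.
Proof. exact: (rmorphD (real_complex R)). Qed.

Lemma rcN (R : realType) (x : R) : rc (- x) = - rc x.
Proof. exact: (rmorphN (real_complex R)). Qed.

Lemma rcM (R : realType) (x y : R) : rc (x * y) = rc x * rc y.
Proof. exact: (rmorphM (real_complex R)). Qed.

Lemma rcV (R : realType) (x : R) : rc x^-1 = (rc x)^-1.
Proof. exact: (fmorphV (real_complex R)). Qed.

Lemma rc_nat (R : realType) (n : nat) : rc (n%:R : R) = n%:R.
Proof. exact: (rmorph_nat (real_complex R)). Qed.

Lemma rc_norm (R : realType) (x : R) : `|rc x| = rc `|x|.
Proof. by rewrite /rc normc_def /= expr0n /= addr0 sqrtr_sqr. Qed.

Lemma ler_rc (R : realType) (x y : R) : (rc x <= rc y) = (x <= y).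
Proof. exact: lecR. Qed.

Lemma ltr_rc (R : realType) (x y : R) : (rc x < rc y) = (x < y).
Proof. exact: ltcR. Qed.

Lemma rc_real_gt0 (R : realType) (e : CC R) : 0 < e -> exists2 x : R, 0 < x & e = rc x.
Proof.
move=> e0; have /complex_realP [x ex] : (e : R[i]) \is Num.real by exact: gtr0_real.
by exists x => //; rewrite -ltr_rc /rc -ex.
Qed.

(** * The complex exponential *)

Lemma CRe_add (R : realType) (z w : CC R) : CRe (z + w) = CRe z + CRe w.
Proof. by case: z w => [a b] [c d]. Qed.

Lemma CIm_add (R : realType) (z w : CC R) : CIm (z + w) = CIm z + CIm w.
Proof. by case: z w => [a b] [c d]. Qed.

Lemma cexpD (R : realType) (z w : CC R) : cexp (z + w) = cexp z * cexp w.
Proof.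
rewrite /cexp CRe_add CIm_add expRD cosD sinD.
apply/eqP; rewrite eq_complex /=; apply/andP; split; apply/eqP; ring.
Qed.

Lemma cexp0 (R : realType) : cexp 0 = 1 :> CC R.
Proof. by rewrite /cexp expR0 cos0 sin0 mulr1 mulr0. Qed.

Lemma cexp_neq0 (R : realType) (z : CC R) : cexp z != 0.
Proof.
apply/eqP => z0; have := cexpD z (- z); rewrite subrr cexp0 z0 mul0r => /eqP.
by rewrite oner_eq0.
Qed.

Lemma cexpN (R : realType) (z : CC R) : cexp (- z) = (cexp z)^-1.
Proof.
apply: (mulIf (cexp_neq0 z)); rewrite mulVf ?cexp_neq0 //.
by rewrite -cexpD addNr cexp0.
Qed.

Lemma cexpMn (R : realType) (n : nat) (z : CC R) : cexp (n%:R * z) = cexp z ^+ n.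
Proof.
elim: n => [|n IH]; first by rewrite mul0r cexp0.
by rewrite -natr1 mulrDl mul1r cexpD IH exprSr.
Qed.

Lemma cexp_rc (R : realType) (x : R) : cexp (rc x) = rc (expR x).
Proof. by rewrite /cexp /= cos0 sin0 mulr1 mulr0. Qed.

Lemma norm_cexp (R : realType) (z : CC R) : `|cexp z| = rc (expR (CRe z)).
Proof.
rewrite normc_def /= !exprMn -mulrDr cos2Dsin2 mulr1 sqrtr_sqr.
by rewrite ger0_norm // expR_ge0.
Qed.

Lemma cexp_i (R : realType) (x : R) : cexp (Ci R * rc x) = mkC (cos x) (sin x).
Proof.
have -> : Ci R * rc x = mkC 0 x.
  by apply/eqP; rewrite eq_complex /=; apply/andP; split; apply/eqP; ring.
by rewrite /cexp /= expR0 !mul1r.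
Qed.

Lemma cexp_ipi (R : realType) : cexp (Ci R * rc pi) = -1.
Proof. by rewrite cexp_i cospi sinpi; apply/eqP; rewrite eq_complex /= oppr0 !eqxx. Qed.

Lemma cexp_2ipi (R : realType) : cexp (2 * Ci R * rc pi) = 1.
Proof. by rewrite -mulrA cexpMn cexp_ipi sqrrN expr1n. Qed.

Lemma C_ReIm (R : realType) (z : CC R) : z = rc (CRe z) + Ci R * rc (CIm z).
Proof. by case: z => a b; apply/eqP; rewrite eq_complex /=; apply/andP; split; apply/eqP; ring. Qed.

Lemma norm_Ci (R : realType) : `|Ci R| = 1.
Proof. by rewrite normc_def /= expr0n add0r expr1n sqrtr1. Qed.

Lemma CiM (R : realType) : Ci R * Ci R = -1.
Proof. by rewrite -expr2; exact: (sqr_i R). Qed.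

Lemma Ci_neq0 (R : realType) : Ci R != 0.
Proof. by rewrite -normr_eq0 norm_Ci oner_eq0. Qed.

Lemma rc_CRe_le (R : realType) (z : CC R) : rc `|CRe z| <= `|z|.
Proof. exact: normc_ge_Re. Qed.

Lemma rc_CIm_le (R : realType) (z : CC R) : rc `|CIm z| <= `|z|.
Proof.
have := rc_CRe_le (- Ci R * z); rewrite normrM normrN norm_Ci mul1r.
by case: z => a b /=; rewrite !mulN1r oppr0 mul0r sub0r opprK.
Qed.

(** * Limits of real and imaginary parts *)

Lemma cvg_rc (R : realType) (T : Type) (F : set_system T) {FF : Filter F} (f : T -> R) (l : R) :
  f @ F --> l -> (fun x => rc (f x)) @ F --> rc l.
Proof.
move=> fl; apply/cvgrPdist_le => e /rc_real_gt0 [d d0 ->].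
have /cvgrPdist_le /(_ d d0) := fl; apply: filterS => x.
by rewrite -rcN -rcD rc_norm ler_rc.
Qed.

Lemma CReB (R : realType) (z w : CC R) : CRe (z - w) = CRe z - CRe w.
Proof. by case: z w => [a b] [c d]. Qed.

Lemma CImB (R : realType) (z w : CC R) : CIm (z - w) = CIm z - CIm w.
Proof. by case: z w => [a b] [c d]. Qed.

Lemma cvg_CRe (R : realType) (T : Type) (F : set_system T) {FF : Filter F} (f : T -> CC R) (l : CC R) :
  f @ F --> l -> (fun x => CRe (f x)) @ F --> CRe l.
Proof.
move=> fl; apply/cvgrPdist_le => e e0.
have e0' : 0 < rc e by rewrite (ltr_rc 0).
have /cvgrPdist_le /(_ _ e0') := fl; apply: filterS => x.
by rewrite -CReB -ler_rc; apply: le_trans (rc_CRe_le _).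
Qed.

Lemma cvg_CIm (R : realType) (T : Type) (F : set_system T) {FF : Filter F} (f : T -> CC R) (l : CC R) :
  f @ F --> l -> (fun x => CIm (f x)) @ F --> CIm l.
Proof.
move=> fl; apply/cvgrPdist_le => e e0.
have e0' : 0 < rc e by rewrite (ltr_rc 0).
have /cvgrPdist_le /(_ _ e0') := fl; apply: filterS => x.
by rewrite -CImB -ler_rc; apply: le_trans (rc_CIm_le _).
Qed.

(** * Derivative of the complex exponential *)

Lemma is_derive0_first_order (R : realType) (f : R -> R) (d : R) : is_derive (0:R) (1:R) f d ->
  forall e : R, 0 < e -> \forall x \near (0:R), `|f x - f 0 - d * x| <= e * `|x|.
Proof.
move=> [df dd] e e0.
have : (fun h => h^-1 *: ((f \o shift 0) (h *: 1) - f 0)) @ (0:R)^' --> d.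
  by rewrite -dd; exact: df.
move=> /cvgrPdist_le /(_ e e0); rewrite near_withinE.
apply: filterS => x; have [->|x0 /(_ isT)] := eqVneq x 0.
  by rewrite !mulr0 subrr subr0 normr0 mulr0.
rewrite /= addr0 [x *: 1]mulr1 distrC => H.
have -> : f x - f 0 - d * x = (x^-1 *: (f x - f 0) - d) * x.
  by rewrite mulrBl [_ *: _]mulrC divfK.
by rewrite normrM ler_wpM2r.
Qed.

Lemma norm_CC_le (R : realType) (z : CC R) : `|z| <= rc (`|CRe z| + `|CIm z|).
Proof.
rewrite {1}(C_ReIm z) (le_trans (ler_normD _ _)) // normrM norm_Ci mul1r !rc_norm -rcD.
by rewrite lexx.
Qed.

(** The derivative of [cexp] at 0. Writing h = x + iy and E = e^(iy),
    e^h - 1 - h = (e^x - 1 - x) E + x (E - 1) + (E - 1 - i y),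
    where the first and last terms are controlled by the real derivatives of
    exp, cos and sin at 0 and the middle one is of second order. *)
Lemma cexp_first_order (R : realType) (e : CC R) : 0 < e ->
  \forall h \near (0 : CC R), `|cexp h - 1 - h| <= e * `|h|.
Proof.
move=> /rc_real_gt0 [e0 e0gt ->].
(* the three terms are bounded by d |h|, 3 d |h| and 2 d |h| *)
pose d := Num.min 1 (e0 / 6).
have d0 : 0 < d by rewrite lt_min ltr01 divr_gt0.
have d1 : d <= 1 by rewrite ge_min lexx.
have de : 6 * d <= e0 by rewrite mulrC -ler_pdivlMr // ge_min lexx orbT.
have D1 : is_derive (0:R) 1 expR 1 by have := is_derive_expR (0:R); rewrite expR0.
have D2 : is_derive (0:R) 1 (@cos R) 0 by have := is_derive_cos (0:R); rewrite sin0 oppr0.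
have D3 : is_derive (0:R) 1 (@sin R) 1 by have := is_derive_sin (0:R); rewrite cos0.
have cR : (fun z : CC R => CRe z) @ (0 : CC R) --> (0 : R).
  apply: (@cvg_CRe R (CC R) (nbhs (0 : CC R)) _ id 0); exact: cvg_id.
have cI : (fun z : CC R => CIm z) @ (0 : CC R) --> (0 : R).
  apply: (@cvg_CIm R (CC R) (nbhs (0 : CC R)) _ id 0); exact: cvg_id.
have E1 := cR _ (@is_derive0_first_order R expR 1 D1 d d0).
have E2 := cI _ (@is_derive0_first_order R cos 0 D2 d d0).
have E3 := cI _ (@is_derive0_first_order R sin 1 D3 d d0).
have E4 : \forall h \near (0 : CC R), `|h| <= rc d.
  by apply: (@nbhs0_le (CC R) (CC R)); rewrite (ltr_rc 0).
near=> h.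
have H1 : `|expR (CRe h) - 1 - CRe h| <= d * `|CRe h|.
  rewrite -[X in _ - X]mul1r -[X in _ - X - _](expR0 R).
  by near: h; exact: E1.
have H2 : `|cos (CIm h) - 1| <= d * `|CIm h|.
  rewrite -[X in `|X|]subr0 -[X in _ - X](mul0r (CIm h)) -[X in _ - X - _](cos0 R).
  by near: h; exact: E2.
have H3 : `|sin (CIm h) - CIm h| <= d * `|CIm h|.
  rewrite -[X in X - _]subr0 -[X in _ - X - _](sin0 R) -[X in _ - _ - X](mul1r (CIm h)).
  by near: h; exact: E3.
have H4 : `|h| <= rc d.
  by near: h; exact: E4.
set x := CRe h in H1 *; set y := CIm h in H2 H3 *.
have hn : exists2 n : R, `|h| = rc n & 0 <= n.
  exists (complex.Re `|h|); last by rewrite -ler_rc; have := normr_ge0 h; rewrite normc_def.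
  by rewrite normc_def.
have [n nE n0] := hn.
have xn : `|x| <= n by rewrite -ler_rc -nE rc_CRe_le.
have yn : `|y| <= n by rewrite -ler_rc -nE rc_CIm_le.
have nd : n <= d by rewrite -ler_rc -nE.
pose E := cexp (Ci R * rc y).
have nE1 : `|E| = 1 by rewrite norm_cexp /= mul0r mul1r subrr expR0.
have hE : h = rc x + Ci R * rc y by exact: C_ReIm.
have H5 : `|E - 1 - Ci R * rc y| <= rc (2 * d * n).
  apply: le_trans (norm_CC_le _) _; rewrite ler_rc.
  have -> : E - 1 - Ci R * rc y = mkC (cos y - 1) (sin y - y).
    by rewrite /E cexp_i; apply/eqP; rewrite eq_complex /=; apply/andP; split; apply/eqP; ring.
  rewrite /=.
  have := ler_wpM2l (ltW d0) yn; lra.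
have H6 : `|E - 1| <= rc (3 * n).
  have -> : E - 1 = (E - 1 - Ci R * rc y) + Ci R * rc y by rewrite subrK.
  apply: le_trans (ler_normD _ _) _; rewrite normrM norm_Ci mul1r rc_norm.
  apply: le_trans (lerD H5 (lexx _)) _; rewrite -rcD ler_rc.
  have := ler_wpM2r n0 d1; lra.
rewrite nE.
have -> : cexp h - 1 - h = rc (expR x - 1 - x) * E + rc x * (E - 1) + (E - 1 - Ci R * rc y).
  rewrite {1}hE cexpD cexp_rc -/E hE !rcD !rcN; ring.
apply: le_trans (ler_normD _ _) _.
apply: le_trans (lerD (ler_normD _ _) H5) _.
rewrite !normrM nE1 mulr1 !rc_norm.
apply: le_trans (lerD (lerD (lexx _) (ler_wpM2l _ H6)) (lexx _)) _.
  by rewrite (ler_rc 0).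
rewrite -!rcM -!rcD ler_rc.
have := ler_wpM2l (ltW d0) xn; have := ler_wpM2r n0 xn.
have := ler_wpM2r n0 nd; have := ler_wpM2r n0 de; lra.
Unshelve. all: by end_near. Qed.

Lemma is_derive_cexpM (R : realType) (c t : CC R) :
  is_derive t 1 (fun t => cexp (c * t)) (c * cexp (c * t)).
Proof.
suff H : (fun h : CC R => h^-1 *: (((fun t => cexp (c * t)) \o shift t) (h *: 1) - cexp (c * t))) @ (0 : CC R)^' --> c * cexp (c * t).
  by split; [apply/cvg_ex; exists (c * cexp (c * t)) | exact: cvg_lim H].
apply/cvgrPdist_le => e e0; rewrite near_withinE.
have n0 : 0 < `|c| * `|cexp (c * t)| + 1 by apply: ltr_pwDr => //; exact: mulr_ge0.
have e1 : 0 < e / (`|c| * `|cexp (c * t)| + 1) by exact: divr_gt0.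
have E := cexp_first_order e1.
have ch : (fun h : CC R => c * h) @ (0 : CC R) --> (0 : CC R).
  by rewrite -[X in _ --> X](mulr0 c); exact: mulrl_continuous.
near=> h => h0.
have H : `|cexp (c * h) - 1 - c * h| <= e / (`|c| * `|cexp (c * t)| + 1) * `|c * h|.
  by near: h; exact: (ch _ E).
rewrite /= [h *: 1]mulr1 mulrDr cexpD.
have -> : c * cexp (c * t) - h^-1 *: (cexp (c * h) * cexp (c * t) - cexp (c * t)) =
   - (h^-1 * (cexp (c * h) - 1 - c * h)) * cexp (c * t).
  rewrite [_ *: _]mulrC; apply: (mulIf h0); rewrite !mulrBl mulrVK ?unitfE //.
  by field.
rewrite normrM normrN normrM normfV.
have {}H := ler_wpM2r (normr_ge0 (cexp (c * t))) (ler_wpM2l (_ : 0 <= `|h|^-1) H).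
apply: le_trans (H _) _; first by rewrite invr_ge0.
have hn0 : `|h| != 0 by rewrite normr_eq0.
have -> : `|h|^-1 * (e / (`|c| * `|cexp (c * t)| + 1) * `|c * h|) * `|cexp (c * t)|
   = e * ((`|c| * `|cexp (c * t)|) / (`|c| * `|cexp (c * t)| + 1)).
  by rewrite normrM; field; rewrite hn0 gt_eqF.
rewrite ler_piMr ?(ltW e0) // ler_pdivrMr // mul1r lerDl ler01.
Unshelve. all: by end_near. Qed.

Lemma is_derive_cexp (R : realType) (t : CC R) : is_derive t 1 (@cexp R) (cexp t).
Proof.
have := is_derive_cexpM 1 t; rewrite !mul1r.
by rewrite (_ : (fun t => _) = @cexp R) //; apply/funext => z; rewrite mul1r.
Qed.

(** * Derivatives of functions of a complex variable *)

(** Restriction to a real line followed by the real part: this is what makes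
    real one-variable analysis (mean value theorem, functions with zero
    derivative) applicable to functions of a complex variable. *)
Lemma is_derive_line (R : realType) (F : CC R -> CC R) (z v d : CC R) (s : R) :
  is_derive (z + rc s * v) 1 F d ->
  is_derive s (1:R) (fun s => CRe (F (z + rc s * v))) (CRe (d * v)).
Proof.
have [->|v0] := eqVneq v 0.
  move=> _; rewrite mulr0 (_ : (fun s => _) = cst (CRe (F z))).
    exact: is_derive_cst.
  by apply/funext => x; rewrite mulr0 addr0.
move=> [dF Fd].
suff H : (fun h : R => h^-1 *: (((fun s => CRe (F (z + rc s * v))) \o shift s) (h *: 1) - CRe (F (z + rc s * v)))) @ (0 : R)^' --> CRe (d * v).
  by split; [apply/cvg_ex; exists (CRe (d * v)) | exact: cvg_lim H].
have H : (fun h : CC R => h^-1 * (F (h + (z + rc s * v)) - F (z + rc s * v))) @ (0 : CC R)^' --> d.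
  rewrite -Fd; suff -> : (fun h : CC R => h^-1 * (F (h + (z + rc s * v)) - F (z + rc s * v))) =
    (fun h : CC R => h^-1 *: ((F \o shift (z + rc s * v)) (h *: 1) - F (z + rc s * v))) by exact: dF.
  by apply/funext => h /=; rewrite [h *: 1]mulr1.
have C : (fun h : R => rc h * v) @ (0 : R)^' --> (0 : CC R)^'.
  have c0 : (fun h : R => rc h * v) @ (0 : R) --> (0 : CC R).
    rewrite -[X in _ --> X](mul0r v); apply: cvgMr_tmp; exact: cvg_rc cvg_id.
  move=> A A0; have {}A0 : \forall z \near (0 : CC R)^', A z by [].
  change (\forall h \near (0 : R)^', A (rc h * v)).
  have B := c0 _ A0.
  change (nbhs (0 : R) (fun h : R => rc h * v != 0 -> A (rc h * v))) in B.
  change (nbhs (0 : R) (fun h : R => h != 0 -> A (rc h * v))).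
  apply: filterS B => h /= Ah h0; apply: Ah.
  by rewrite mulf_neq0 //; apply: contra_neq h0 => /(congr1 (@CRe R)).
have H2 : (fun h : R => (rc h * v)^-1 * (F (rc h * v + (z + rc s * v)) - F (z + rc s * v)) * v) @ (0 : R)^' --> d * v.
  apply: cvgMr_tmp; exact: cvg_comp C H.
apply: cvg_trans (cvg_CRe H2); apply: near_eq_cvg; near=> h.
have h0 : h != 0 by near: h; exact: nbhs_dnbhs_neq.
have rh0 : rc h != 0 by apply: contra_neq h0 => /(congr1 (@CRe R)).
rewrite /= ![_ *: 1]mulr1 -CReB rcD mulrDl.
rewrite [rc h * v + (_ + _)]addrCA.
have -> : (rc h * v)^-1 * (F (z + (rc h * v + rc s * v)) - F (z + rc s * v)) * v =
  rc h^-1 * (F (z + (rc h * v + rc s * v)) - F (z + rc s * v)).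
  by rewrite rcV; field; rewrite v0 rh0.
by case: (_ - _) => x y /=; rewrite mul0r subr0.
Unshelve. all: by end_near. Qed.

Definition has_derivative (R : realType) (F : CC R -> CC R) (t d : CC R) : Prop :=
  is_derive t (1 : CC R) F d.

Lemma has_derivative_eq (R : realType) (F G : CC R -> CC R) (t d e : CC R) :
  has_derivative F t d -> F =1 G -> d = e -> has_derivative G t e.
Proof. by move=> dF /funext <- <-. Qed.

Lemma has_derivative_cst (R : realType) (c t : CC R) : has_derivative (fun=> c) t 0.
Proof. exact: is_derive_cst. Qed.

Lemma has_derivative_id (R : realType) (t : CC R) : has_derivative id t 1.
Proof. exact: is_derive_id. Qed.

Lemma has_derivativeD (R : realType) (F G : CC R -> CC R) (t d e : CC R) :
  has_derivative F t d -> has_derivative G t e ->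
  has_derivative (fun t => F t + G t) t (d + e).
Proof. exact: is_deriveD. Qed.

Lemma has_derivativeB (R : realType) (F G : CC R -> CC R) (t d e : CC R) :
  has_derivative F t d -> has_derivative G t e ->
  has_derivative (fun t => F t - G t) t (d - e).
Proof. exact: is_deriveB. Qed.

Lemma has_derivativeM (R : realType) (F G : CC R -> CC R) (t d e : CC R) :
  has_derivative F t d -> has_derivative G t e ->
  has_derivative (fun t => F t * G t) t (d * G t + F t * e).
Proof.
move=> dF dG; apply: has_derivative_eq (is_deriveM dF dG) _ _ => //.
by rewrite addrC mulrC.
Qed.

Lemma has_derivativeZ (R : realType) (F : CC R -> CC R) (c t d : CC R) :
  has_derivative F t d -> has_derivative (fun t => c * F t) t (c * d).
Proof. exact: is_deriveZ. Qed.

Lemma has_derivativeV (R : realType) (F : CC R -> CC R) (t d : CC R) :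
  has_derivative F t d -> F t != 0 ->
  has_derivative (fun t => (F t)^-1) t (- d / F t ^+ 2).
Proof.
move=> [dF <-] F0; split; first exact: derivableV.
by rewrite deriveV // [_ *: _]mulrC mulrN mulNr.
Qed.

Lemma has_derivative_div (R : realType) (F G : CC R -> CC R) (t d e : CC R) :
  has_derivative F t d -> has_derivative G t e -> G t != 0 ->
  has_derivative (fun t => F t / G t) t ((d * G t - F t * e) / G t ^+ 2).
Proof.
move=> dF dG G0; apply: has_derivative_eq (has_derivativeM dF (has_derivativeV dG G0)) _ _ => //.
by field.
Qed.

Lemma has_derivative_shift (R : realType) (F : CC R -> CC R) (t c d : CC R) :
  has_derivative F (t + c) d -> has_derivative (fun t => F (t + c)) t d.
Proof.
move=> [dF dd]; have E : (fun h : CC R => h^-1 *: ((F \o shift (t + c)) (h *: 1) - F (t + c))) =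
   (fun h : CC R => h^-1 *: (((fun t => F (t + c)) \o shift t) (h *: 1) - F (t + c))).
  by apply/funext => h /=; rewrite addrA.
by split; [rewrite /derivable -E | rewrite -dd /derive -E].
Qed.

(** Used to turn the approach to the origin, t --> -oo, into s --> +oo. *)
Lemma has_derivative_opp (R : realType) (F : CC R -> CC R) (t d : CC R) :
  has_derivative F (- t) d -> has_derivative (fun t => F (- t)) t (- d).
Proof.
move=> [dF dd]; suff H : (fun h : CC R => h^-1 *: (((fun t => F (- t)) \o shift t) (h *: 1) - F (- t))) @ (0 : CC R)^' --> - d.
  by split; [apply/cvg_ex; exists (- d) | exact: cvg_lim H].
have H : (fun h : CC R => h^-1 *: ((F \o shift (- t)) (h *: 1) - F (- t))) @ (0 : CC R)^' --> d.
  by rewrite -dd; exact: dF.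
have C : (fun h : CC R => - h) @ (0 : CC R)^' --> (0 : CC R)^'.
  move=> A A0.
  have B : (fun h : CC R => - h) @ (0 : CC R) --> (0 : CC R).
    by have := @oppr_continuous (CC R) (CC R) 0; rewrite /continuous_at oppr0.
  have {}B := B _ A0.
  change (nbhs (0 : CC R) (fun h : CC R => - h != 0 -> A (- h))) in B.
  change (nbhs (0 : CC R) (fun h : CC R => h != 0 -> A (- h))).
  by apply: filterS B => h Ah h0; apply: Ah; rewrite oppr_eq0.
have H' : (fun h : CC R => - ((- h)^-1 *: ((F \o shift (- t)) ((- h) *: 1) - F (- t)))) @ (0 : CC R)^' --> - d.
  apply: cvgN; exact: (cvg_comp _ _ C H).
suff <- : (fun h : CC R => - ((- h)^-1 *: ((F \o shift (- t)) ((- h) *: 1) - F (- t)))) =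
  (fun h : CC R => h^-1 *: (((fun t => F (- t)) \o shift t) (h *: 1) - F (- t))) by exact: H'.
apply/funext => h; rewrite /= ![_ *: 1]mulr1 invrN scaleNr opprK opprD.
by [].
Qed.

Lemma is_derive1_chain (K : numFieldType) (f g : K -> K) (x d e : K) :
  is_derive x 1 g e -> is_derive (g x) 1 f d -> is_derive x 1 (f \o g) (d * e).
Proof.
move=> [/derivable1_diffP dg <-] [/derivable1_diffP df <-].
have dfg : differentiable (f \o g) x by exact: differentiable_comp.
split; first exact/derivable1_diffP.
rewrite -!derive1E !derive1E' // diff_comp //= -[X in 'd  _ _ X = _]mulr1.
by rewrite [LHS]linearZ mulrC.
Qed.

Lemma has_derivative_comp (R : realType) (F G : CC R -> CC R) (t d e : CC R) :
  has_derivative G t e -> has_derivative F (G t) d ->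
  has_derivative (fun t => F (G t)) t (d * e).
Proof. exact: is_derive1_chain. Qed.

Lemma has_derivative0_cst (R : realType) (F : CC R -> CC R) :
  (forall t, has_derivative F t 0) -> forall t t', F t = F t'.
Proof.
move=> dF t t'.
(* real parts suffice: the imaginary part of F is the real part of - i F *)
have ReF G : (forall t, has_derivative G t 0) -> CRe (G t) = CRe (G t').
  move=> dG.
  have H s : is_derive s (1:R) (fun s => CRe (G (t + rc s * (t' - t)))) 0.
    by have := is_derive_line (dG (t + rc s * (t' - t))); rewrite mul0r.
  have := @is_derive_0_is_cst R _ 0 1 H.
  by rewrite !mul0r addr0 mul1r addrC subrK.
have H := ReF F dF.
have dG u : has_derivative (fun t => - Ci R * F t) u 0.
  by have := has_derivativeZ (- Ci R) (dF u); rewrite mulr0.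
have := ReF _ dG; rewrite (C_ReIm (F t)) (C_ReIm (F t')) H => H2.
congr (_ + _ * rc _); move: H2.
case: (F t) (F t') => [x y] [x' y'] /=.
lra.
Qed.

(** * A convergent function has no persistent derivative *)

(** If c were not 0, then the real part of (conjugate of c) h would have a
    derivative bounded below by a positive constant near +oo, because dividing
    by the factor k, which is at most 1, only increases it; by the mean value
    theorem it would increase by a fixed amount on intervals of length 1
    arbitrarily far away, so that h could not converge. The factor k is there
    for derivatives that are only known to converge after rescaling. *)
Lemma scaled_derivative_lim0 (R : realType) (h D : CC R -> CC R) (k : R -> R) (l c : CC R) :
  (\forall s \near +oo, has_derivative h (rc s) (D (rc s))) ->
  (\forall s \near +oo, 0 < k s <= 1) ->
  (fun s => h (rc s)) @ +oo --> l ->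
  (fun s => rc (k s) * D (rc s)) @ +oo --> c ->
  c = 0.
Proof.
move=> dh k01 hl Dc; apply/eqP/negPn/negP => c0.
(* cb is the conjugate of c, so cb * c = 2 e, and the derivative of G is
   eventually at least e *)
pose e : R := (complex.Re `|c|) ^+ 2 / 2.
have nc : `|c| = rc (complex.Re `|c|) by rewrite normc_def.
have n0 : 0 < complex.Re `|c| by rewrite -ltr_rc -nc normr_gt0.
have e0 : 0 < e by rewrite divr_gt0 // exprn_gt0.
have [cb cc] : exists cb : CC R, cb * c = rc (2 * e).
  exists (conjc c).
  by rewrite mulrC -sqr_normc nc /e mulrC divfK ?pnatr_eq0 // expr2 rcM.
pose G (s : R) : R := CRe (cb * h (rc s)).
have dG : \forall s \near +oo, is_derive s (1:R) G (CRe (cb * D (rc s))).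
  apply: filterS dh => s ds.
  have -> : G = fun s => CRe ((fun t => cb * h t) (0 + rc s * 1)).
    by apply/funext => u; rewrite /G add0r mulr1.
  have -> : cb * D (rc s) = cb * D (rc s) * 1 :> CC R by rewrite mulr1.
  by apply: (@is_derive_line R (fun t => cb * h t) 0 1); rewrite add0r mulr1; exact: has_derivativeZ.
have bD : \forall s \near +oo, e <= CRe (cb * D (rc s)).
  have /cvg_CRe : (fun s => cb * (rc (k s) * D (rc s))) @ +oo --> cb * c.
    exact: cvgMl_tmp.
  rewrite cc => /cvgr_ge /(_ e) H.
  near=> s.
  have k0 : 0 < k s <= 1 by near: s; exact: k01.
  have : e <= CRe (cb * (rc (k s) * D (rc s))).
    by near: s; apply: H => /=; lra.
  rewrite mulrCA; case: (cb * D (rc s)) => x y /=; rewrite mul0r subr0.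
  move=> He; case/andP: k0 => k0 k1.
  have x0 : 0 < x by rewrite -(pmulr_rgt0 _ k0); apply: lt_le_trans He.
  by apply: le_trans He _; rewrite ger_pMl.
have hG : G @ +oo --> CRe (cb * l).
  have Hl : (fun s => cb * h (rc s)) @ +oo --> cb * l.
    exact: (cvgM (cvg_cst cb) hl).
  exact: (cvg_CRe Hl).
have [A [Areal HA]] : \forall s \near +oo, [/\ is_derive s (1:R) G (CRe (cb * D (rc s))),
    e <= CRe (cb * D (rc s)) & `|CRe (cb * l) - G s| <= e / 4].
  near=> s; split; [by near: s | by near: s |].
  near: s; move/cvgrPdist_le : hG; apply; lra.
(* the increment over [A + 1, A + 2] is at least e, but both ends are within
   e / 4 of the limit *)
have [] := @MVT R G (fun s => CRe (cb * D (rc s))) (A + 1) (A + 2).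
- lra.
- by move=> x; rewrite in_itv /= => /andP[x1 x2]; have [] := HA x; first lra.
- apply: derivable_within_continuous => x; rewrite in_itv /= => /andP[x1 x2].
  by have [] := HA x; first lra.
move=> x; rewrite in_itv /= => /andP[x1 x2] E.
have [_ H1 _] : [/\ is_derive x (1:R) G (CRe (cb * D (rc x))),
    e <= CRe (cb * D (rc x)) & `|CRe (cb * l) - G x| <= e / 4] by apply: HA; lra.
have [|_ _ H2] := HA (A + 1); first lra.
have [|_ _ H3] := HA (A + 2); first lra.
move: H2 H3; rewrite !ler_norml => /andP[H2 H2'] /andP[H3 H3'].
move: E; have -> : A + 2 - (A + 1) = 1 by ring.
rewrite mulr1; lra.
Unshelve. all: by end_near. Qed.

(** * Power series near the origin *)

(** Convergence at one point y0 bounds |C k| |y0|^k by some M, and then the tail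
    of order n at y is dominated by a geometric series of ratio at most 1/2.
    The bound M does not depend on y, which is what the passage to the limit
    y --> 0 needs. *)
Lemma pseries_tail_bound (K : numFieldType) (C : nat -> K) (y0 : K) :
  y0 != 0 -> cvgn (series (fun k => C k * y0 ^+ k)) ->
  exists M : K, 0 <= M /\ forall n y l, `|y| <= `|y0| / 2 ->
    series (fun k => C k * y ^+ k) @ \oo --> l ->
    `|l - \sum_(0 <= k < n) C k * y ^+ k| <= M * (`|y| / `|y0|) ^+ n.
Proof.
move=> y00 cv.
have [M0 [M0real M0b]] := cvg_seq_bounded (cvgP _ (cvg_series_cvg_0 cv)).
pose M := `|M0| + 1.
have Mgt : M0 < M.
  by rewrite (le_lt_trans (real_ler_norm M0real)) // ltrDl.
have Mge : 0 <= M by rewrite addr_ge0.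
have Mb k : `|C k| * `|y0| ^+ k <= M.
  by rewrite -normrX -normrM; exact: (M0b M Mgt k I).
exists (2 * M); split; first by rewrite mulr_ge0.
move=> n y l ly sl.
set r := `|y| / `|y0|.
have y0gt : 0 < `|y0| by rewrite normr_gt0.
have r0 : 0 <= r by rewrite divr_ge0.
have r2 : 2 * r <= 1 by rewrite mulrA ler_pdivrMr // mul1r mulrC -ler_pdivlMr.
have rn k : 0 <= r ^+ k by exact: exprn_ge0.
have tm k : `|C k * y ^+ k| <= M * r ^+ k.
  rewrite normrM normrX /r expr_div_n mulrA ler_pdivlMr ?exprn_gt0 // mulrAC.
  by rewrite ler_wpM2r // exprn_ge0.
(* r <= 1/2 makes the partial tails telescope, with no division by 1 - r *)
have part j : `|\sum_(n <= k < n + j) C k * y ^+ k| <= 2 * M * (r ^+ n - r ^+ (n + j)).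
  elim: j => [|j IH]; first by rewrite addn0 big_geq // normr0 subrr mulr0.
  rewrite addnS big_nat_recr /= ?leq_addr //.
  apply: le_trans (ler_normD _ _) _; apply: le_trans (lerD IH (tm _)) _.
  rewrite exprS -subr_ge0.
  have -> : 2 * M * (r ^+ n - r * r ^+ (n + j)) -
    (2 * M * (r ^+ n - r ^+ (n + j)) + M * r ^+ (n + j)) =
    M * r ^+ (n + j) * (1 - 2 * r) by ring.
  by rewrite !mulr_ge0 // subr_ge0.
apply/ler_addgt0Pr => e e0.
have /cvgrPdist_le /(_ e e0) : series (fun k => C k * y ^+ k) @ \oo --> l := sl.
move=> [N _ HN].
have := HN (n + N)%N (leq_addl _ _); rewrite /series /= => HN1.
rewrite (big_cat_nat (n := n)) ?leq_addr //= in HN1.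
set S := \sum_(0 <= k < n) _ in HN1 *.
set S1 := \sum_(n <= k < n + N) _ in HN1.
have -> : l - S = S1 + (l - (S + S1)) by ring.
apply: le_trans (ler_normD _ _) _; apply: lerD => //.
apply: le_trans (part N) _; rewrite ler_wpM2l ?mulr_ge0 //.
by rewrite gerBl.
Qed.

(** The sum is C n y^n up to a tail of order n + 1. It is enough to know the
    series at the points visited by the filter: below they lie on a ray, not in
    a full neighbourhood of 0. *)
Lemma pseries_leading_coef (K : numFieldType) (T : Type) (F : set_system T)
    {FF : ProperFilter F} (C : nat -> K) (y d : T -> K) (n : nat) :
  y @ F --> (0 : K) -> (\forall x \near F, y x != 0) ->
  (\forall x \near F, series (fun k => C k * y x ^+ k) @ \oo --> d x) ->
  (forall j, (j < n)%N -> C j = 0) ->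
  (fun x => d x / y x ^+ n) @ F --> C n.
Proof.
move=> y0 yn0 ser C0.
have [x0 [x0n0 x0s]] := filter_ex (filterI yn0 ser).
have [M [M0 HM]] := pseries_tail_bound x0n0 (cvgP _ x0s).
have x0gt : 0 < `|y x0| by rewrite normr_gt0.
have HC : (fun x => `|d x / y x ^+ n - C n|) @ F --> (0 : K).
  apply/cvgr0Pnorm_le => e e0.
  have M1 : 0 < M / `|y x0| ^+ n.+1 + 1.
    by rewrite ltr_wpDl // divr_ge0 // exprn_ge0.
  have yb : \forall x \near F, `|y x| <= `|y x0| / 2.
    by move/cvgr0Pnorm_le : y0; apply; rewrite divr_gt0.
  have ye : \forall x \near F, `|y x| <= e / (M / `|y x0| ^+ n.+1 + 1).
    by move/cvgr0Pnorm_le : y0; apply; rewrite divr_gt0.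
  near=> x; rewrite normr_id.
  have xn0 : y x != 0 by near: x.
  have h1 : `|y x| <= `|y x0| / 2 by near: x.
  have h2 : `|y x| <= e / (M / `|y x0| ^+ n.+1 + 1) by near: x.
  have h3 : series (fun k => C k * y x ^+ k) @ \oo --> d x by near: x.
  have := HM n.+1 (y x) (d x) h1 h3.
  rewrite big_nat_recr //= big_nat_cond big1; last first.
    by move=> j; rewrite andbT => /C0 ->; rewrite mul0r.
  rewrite add0r => H.
  have -> : d x / y x ^+ n - C n = (d x - C n * y x ^+ n) / y x ^+ n.
    by rewrite mulrBl mulfK // expf_neq0.
  rewrite normrM normfV normrX ler_pdivrMr ?exprn_gt0 ?normr_gt0 //.
  apply: le_trans H _.
  have -> : M * (`|y x| / `|y x0|) ^+ n.+1 = M / `|y x0| ^+ n.+1 * `|y x| * `|y x| ^+ n.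
    by rewrite expr_div_n [`|y x| ^+ n.+1]exprS; ring.
  rewrite ler_wpM2r ?exprn_ge0 //.
  move: h2; rewrite ler_pdivlMr // mulrDr mulr1 mulrC; apply: le_trans.
  by rewrite lerDl.
by move/norm_cvg0P : HC => HC; apply/subr_cvg0.
Unshelve. all: by end_near. Qed.

(** The coefficients of the difference vanish one after the other: once those
    of index less than n are 0, the n-th is the limit of 0 / y^n. *)
Lemma pseries_coef_unique (K : numFieldType) (T : Type) (F : set_system T)
    {FF : ProperFilter F} (A B : nat -> K) (y d : T -> K) :
  y @ F --> (0 : K) -> (\forall x \near F, y x != 0) ->
  (\forall x \near F, series (fun k => A k * y x ^+ k) @ \oo --> d x) ->
  (\forall x \near F, series (fun k => B k * y x ^+ k) @ \oo --> d x) ->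
  A =1 B.
Proof.
move=> y0 yn0 sA sB.
suff H n : A n - B n = 0 by move=> n; apply/eqP; rewrite -subr_eq0 H.
have sC : \forall x \near F, series (fun k => (A k - B k) * y x ^+ k) @ \oo --> (0 : K).
  near=> x.
  have -> : (fun k => (A k - B k) * y x ^+ k) =
    (fun k => A k * y x ^+ k) - (fun k => B k * y x ^+ k).
    by apply/funext => k; rewrite mulrBl.
  have -> : series ((fun k => A k * y x ^+ k) - (fun k => B k * y x ^+ k)) =
    series (fun k => A k * y x ^+ k) - series (fun k => B k * y x ^+ k).
    by apply/funext => N; rewrite /series /= sumrB.
  rewrite -(subrr (d x)); apply: cvgB; by near: x.
elim/ltn_ind : n => n IH.
have H : (fun x => 0 / y x ^+ n) @ F --> A n - B n.
  exact: pseries_leading_coef y0 yn0 sC IH.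
have H0 : (fun x => 0 / y x ^+ n) @ F --> (0 : K).
  by rewrite (_ : (fun x => _) = fun=> 0); [exact: cvg_cst|apply/funext => x; rewrite mul0r].
exact: norm_cvg_unique H H0.
Unshelve. all: by end_near. Qed.

(** * Decay along the real axis *)

Lemma cvg_expRNM (R : realType) (c : R) : 0 < c ->
  (fun s : R => expR (- (c * s))) @ +oo --> (0 : R).
Proof.
move=> c0; have := @cvgr_expR R; apply: cvg_comp.
apply/cvgryPge => A; near=> s.
have As : A / c <= s by near: s; apply: nbhs_pinfty_ge; exact: num_real.
by rewrite mulrC -ler_pdivrMr.
Unshelve. all: by end_near. Qed.

Lemma cvg_cexpN (R : realType) : (fun s : R => cexp (- rc s)) @ +oo --> (0 : CC R).
Proof.
rewrite (_ : (fun s => _) = (fun s : R => rc (expR (- s)))).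
  exact: (cvg_rc (@cvgr_expR R)).
by apply/funext => s; rewrite -rcN cexp_rc.
Qed.

(** s e^(-s) <= 2 e^(-s/2), since s / 2 <= e^(s/2). *)
Lemma cvg_mul_cexpN (R : realType) : (fun s : R => rc s * cexp (- rc s)) @ +oo --> (0 : CC R).
Proof.
rewrite (_ : (fun s => _) = (fun s : R => rc (s * expR (- s)))); last first.
  by apply/funext => s; rewrite -rcN cexp_rc -rcM.
apply: (@cvg_rc R _ _ _ _ 0).
have H : (fun s : R => 2 * expR (- (s / 2))) @ +oo --> (0 : R).
  rewrite -(mulr0 2); apply: cvgMl_tmp.
  rewrite (_ : (fun s => _) = (fun s : R => expR (- (2^-1 * s)))); last first.
    by apply/funext => s; rewrite mulrC.
  exact: cvg_expRNM.
apply: (squeeze_cvgr _ (cvg_cst 0) H); near=> s.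
have s0 : 0 <= s by near: s; exact: nbhs_pinfty_ge.
rewrite mulr_ge0 ?expR_ge0 //=.
have -> : - s = - (s / 2) - (s / 2) by field.
rewrite expRD mulrA ler_wpM2r ?expR_ge0 //.
have : s / 2 <= expR (s / 2) by apply: le_trans (expR_ge1Dx _); rewrite lerDr.
rewrite -(ler_pM2r (expR_gt0 (- (s / 2)))) -expRD subrr expR0.
by rewrite mulrAC ler_pdivrMr // mul1r.
Unshelve. all: by end_near. Qed.

(** * Rotations of the covering *)

(** The translation of t that corresponds to the multiplication of x by
    omega^c. *)
Definition turn (R : realType) (m : nat) (c : CC R) : CC R := 2 * Ci R * rc pi * c / m%:R.

Lemma omegaE (R : realType) (m : nat) (c : CC R) : omega m c = cexp (turn m c).
Proof. by []. Qed.

Lemma turnD (R : realType) (m : nat) (c d : CC R) : turn m (c + d) = turn m c + turn m d.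
Proof. by rewrite /turn mulrDr mulrDl. Qed.

Lemma turn_natM (R : realType) (m n : nat) (c : CC R) : turn m (n%:R * c) = n%:R * turn m c.
Proof. by rewrite /turn; ring. Qed.

Lemma omegaD (R : realType) (m : nat) (c d : CC R) : omega m (c + d) = omega m c * omega m d.
Proof. by rewrite !omegaE turnD cexpD. Qed.

Lemma omega0 (R : realType) (m : nat) : omega m 0 = 1 :> CC R.
Proof. by rewrite omegaE /turn mulr0 mul0r cexp0. Qed.

Lemma omega_neq0 (R : realType) (m : nat) (c : CC R) : omega m c != 0.
Proof. exact: cexp_neq0. Qed.

Lemma omegaN (R : realType) (m : nat) (c : CC R) : omega m (- c) = (omega m c)^-1.
Proof.
apply: (mulIf (omega_neq0 m c)).
by rewrite -omegaD addNr omega0 mulVf // omega_neq0.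
Qed.

Lemma omega_natM (R : realType) (m n : nat) (c : CC R) : omega m (n%:R * c) = omega m c ^+ n.
Proof. by rewrite !omegaE turn_natM cexpMn. Qed.

Lemma turn_m (R : realType) (m : nat) : (0 < m)%N -> turn m m%:R = 2 * Ci R * rc pi.
Proof. by move=> m0; rewrite /turn mulfK // pnatr_eq0 -lt0n. Qed.

Lemma omega_m (R : realType) (m : nat) : (0 < m)%N -> omega m m%:R = 1 :> CC R.
Proof. by move=> m0; rewrite omegaE turn_m // cexp_2ipi. Qed.

Lemma omega_nat_root (R : realType) (m n : nat) : (0 < m)%N -> omega m n%:R ^+ m = 1 :> CC R.
Proof. by move=> m0; rewrite -omega_natM mulrC omega_natM omega_m // expr1n. Qed.

Lemma omega_mM (R : realType) (m : nat) (c : CC R) : (0 < m)%N ->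
  omega m (m%:R * c) = cexp (2 * Ci R * rc pi * c).
Proof.
move=> m0; rewrite omegaE; congr cexp; rewrite /turn; field.
by rewrite pnatr_eq0 -lt0n.
Qed.

Lemma dilate1 (R : realType) (n : nat) (a : 'rV[CC R]_n) : dilate 1 a = a.
Proof. by apply/rowP => i; rewrite mxE expr1n mul1r. Qed.

Lemma dilateM (R : realType) (n : nat) (s t : CC R) (a : 'rV[CC R]_n) :
  dilate s (dilate t a) = dilate (s * t) a.
Proof. by apply/rowP => i; rewrite !mxE exprMn mulrA. Qed.

(** A rotation by an m-th root of unity fixes the last parameter, hence p. *)
Lemma dilate_param (R : realType) (m : nat) (s : CC R) (a : 'rV[CC R]_m.-1) (p : CC R) :
  s ^+ m = 1 -> dilate s (param a p) = param (dilate s a) p.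
Proof.
move=> sm; apply/rowP => i; rewrite !mxE.
case: insubP => [j _ ji|]; first by rewrite mxE ji.
rewrite -leqNgt => mi.
have -> : i.+1 = m by apply/eqP; rewrite eqn_leq ltn_ord -ltnS -[X in (X < _)%N](@prednK m) ?ltnS // (leq_ltn_trans _ (ltn_ord i)).
by rewrite sm mul1r.
Qed.

(** The symmetry behind the whole argument: rotating x and the parameters
    together leaves the equation invariant. *)
Lemma Pm_dilate (R : realType) (m : nat) (s x : CC R) (a : 'rV[CC R]_m) :
  s ^+ m = 1 -> Pm (dilate s a) (s * x) = Pm a x.
Proof.
move=> sm; rewrite /Pm exprMn sm mul1r; congr (_ + _); apply: eq_bigr => i _.
by rewrite mxE exprMn mulrACA -exprD subnKC ?sm ?mul1r.
Qed.

(** * Solutions and their Wronskians *)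

(** F1 stands for dF/dx. Naming the derivative lets Wronskians be handled as
    polynomials in F, F1, G and G1. *)
Definition solves (R : realType) (m : nat) (a : 'rV[CC R]_m) (F F1 : CC R -> CC R) :=
  (forall t, has_derivative F t (cexp t * F1 t)) /\
  (forall t, has_derivative F1 t (cexp t * (Pm a (cexp t) / cexp t ^+ 2 * F t))).

Lemma solution_solves (R : realType) (m : nat) (a : 'rV[CC R]_m) (F : CC R -> CC R) :
  solution a F -> solves a F (dx F).
Proof.
have dxE (G : CC R -> CC R) (t : CC R) : derivable G t 1 -> has_derivative G t (cexp t * dx G t).
  move=> dG; split => //; rewrite /dx derive1E mulrC divfK ?cexp_neq0 //.
by move=> [dF dF1 E]; split=> t; [exact: dxE|rewrite -E; exact: dxE].
Qed.

Lemma has_derivative_unique (R : realType) (F : CC R -> CC R) (t d e : CC R) :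
  has_derivative F t d -> has_derivative F t e -> d = e.
Proof. by move=> [_ <-] [_ <-]. Qed.

Lemma solves_unique (R : realType) (m : nat) (a : 'rV[CC R]_m) (F F1 F2 : CC R -> CC R) :
  solves a F F1 -> solves a F F2 -> F1 = F2.
Proof.
move=> [H1 _] [H2 _]; apply/funext => t.
by apply: (mulfI (cexp_neq0 t)); exact: has_derivative_unique (H1 t) (H2 t).
Qed.

Lemma solves_lin (R : realType) (m : nat) (a : 'rV[CC R]_m) (c d : CC R) (F F1 G G1 : CC R -> CC R) :
  solves a F F1 -> solves a G G1 ->
  solves a (fun t => c * F t + d * G t) (fun t => c * F1 t + d * G1 t).
Proof.
move=> [F_ F1_] [G_ G1_]; split=> t.
  apply: has_derivative_eq (has_derivativeD (has_derivativeZ c (F_ t)) (has_derivativeZ d (G_ t))) _ _ => //.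
  ring.
apply: has_derivative_eq (has_derivativeD (has_derivativeZ c (F1_ t)) (has_derivativeZ d (G1_ t))) _ _ => //.
ring.
Qed.

Lemma solvesZ (R : realType) (m : nat) (a : 'rV[CC R]_m) (c : CC R) (F F1 : CC R -> CC R) :
  solves a F F1 -> solves a (fun t => c * F t) (fun t => c * F1 t).
Proof.
move=> sF; have := solves_lin c 0 sF sF.
by congr solves; apply/funext => t; rewrite mul0r addr0.
Qed.

Lemma solves_turn (R : realType) (m : nat) (a : 'rV[CC R]_m) (c : CC R) (F F1 : CC R -> CC R) :
  cexp c ^+ m = 1 -> solves (dilate (cexp c) a) F F1 ->
  solves a (fun t => F (t + c)) (fun t => cexp c * F1 (t + c)).
Proof.
move=> cm [F_ F1_]; split=> t.
  apply: has_derivative_eq (has_derivative_shift (F_ (t + c))) _ _ => //.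
  by rewrite cexpD mulrA.
apply: has_derivative_eq (has_derivativeZ (cexp c) (has_derivative_shift (F1_ (t + c)))) _ _ => //.
have ct := cexp_neq0 t; have cc := cexp_neq0 c.
rewrite cexpD [cexp t * _]mulrC Pm_dilate //; field.
by rewrite ct cc.
Qed.

(** There is no first order term in the equation. *)
Lemma wronskian_cst (R : realType) (m : nat) (a : 'rV[CC R]_m) (F F1 G G1 : CC R -> CC R) :
  solves a F F1 -> solves a G G1 ->
  forall t t', F t * G1 t - F1 t * G t = F t' * G1 t' - F1 t' * G t'.
Proof.
move=> [F_ F1_] [G_ G1_].
apply: (@has_derivative0_cst R (fun t => F t * G1 t - F1 t * G t)) => t.
apply: has_derivative_eq (has_derivativeB (has_derivativeM (F_ t) (G1_ t)) (has_derivativeM (F1_ t) (G_ t))) _ _ => //.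
ring.
Qed.

(** The version for the approach to x = 0 along the positive reals, where
    t = - s with s --> +oo. *)
Lemma derivative_lim0_origin (R : realType) (h D : CC R -> CC R) (l c : CC R) :
  (\forall s \near +oo, has_derivative h (- rc s) (D (- rc s))) ->
  (fun s => h (- rc s)) @ +oo --> l ->
  (fun s => D (- rc s)) @ +oo --> c ->
  c = 0.
Proof.
move=> dh hl Dc; apply/eqP; rewrite -oppr_eq0; apply/eqP.
refine (@scaled_derivative_lim0 R (fun t => h (- t)) (fun t => - D (- t)) (fun=> 1) l (- c) _ _ hl _).
- by apply: filterS dh => s; exact: has_derivative_opp.
- by apply: nearW => s; rewrite ltr01 lexx.
rewrite (_ : (fun s => _) = (fun s => - D (- rc s))); first exact: cvgN.
by apply/funext => s; rewrite mul1r.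
Qed.

Lemma near_neq0_of_cvg1 (R : realType) (f : R -> CC R) :
  f @ +oo --> (1 : CC R) -> \forall s \near +oo, f s != 0.
Proof. by move=> f1; apply: cvgr_neq0 f1 _; exact: oner_neq0. Qed.

(** Let W be the Wronskian and h = x^p G / F, so that h --> c. As
    F^2 = x^(1+p) g^2, the derivative of h in t = ln x is p h + W / g^2, which
    tends to p c + W; this limit must be 0 because h converges. *)
Lemma wronskian_origin (R : realType) (m : nat) (a : 'rV[CC R]_m) (p c : CC R)
    (F F1 G G1 g : CC R -> CC R) :
  solves a F F1 -> solves a G G1 ->
  (forall t, F t = cpow (sp p) t * g (cexp t)) ->
  (fun s => g (cexp (- rc s))) @ +oo --> (1 : CC R) ->
  (fun s => cexp (p * - rc s) * (G (- rc s) / F (- rc s))) @ +oo --> c ->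
  forall t, F t * G1 t - F1 t * G t = - p * c.
Proof.
move=> sF sG FE g1 hc t0; set W := LHS.
have WE t : F t * G1 t - F1 t * G t = W by exact: wronskian_cst sF sG t t0.
have [[dF _] [dG _]] := (sF, sG).
have gn0 := near_neq0_of_cvg1 g1.
pose h t := cexp (p * t) * (G t / F t).
pose D t := p * h t + W / g (cexp t) ^+ 2.
suff : p * c + W / 1 ^+ 2 = 0.
  by rewrite expr1n divr1 mulNr => /eqP; rewrite addrC addr_eq0 => /eqP.
refine (@derivative_lim0_origin R h D c _ _ hc _).
  apply: filterS gn0 => s g0; set t := - rc s in g0 *.
  have F0 : F t != 0 by rewrite FE mulf_neq0 // cexp_neq0.
  apply: has_derivative_eq (has_derivativeM (is_derive_cexpM p t) (has_derivative_div (dG t) (dF t) F0)) _ _ => //.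
  rewrite /D /h -(WE t) -mulrA; congr (_ + _).
  have -> : cexp t * G1 t * F t - G t * (cexp t * F1 t) = cexp t * W.
    by rewrite -(WE t); ring.
  rewrite WE FE /cpow exprMn -cexpMn.
  have -> : 2%:R * (sp p * t) = p * t + t by rewrite /sp; field.
  rewrite cexpD; field.
  by rewrite g0 !cexp_neq0.
apply: cvgD; first exact: cvgMl_tmp.
apply: cvgMl_tmp; apply: cvgV; first by rewrite expr1n oner_neq0.
rewrite !expr2 (_ : (fun s => _) = (fun s => g (cexp (- rc s)) * g (cexp (- rc s)))).
  exact: (cvgM g1 g1).
by apply/funext => s; rewrite expr2.
Qed.

Lemma cvg_entire0 (R : realType) (g : CC R -> CC R) (A : nat -> CC R) :
  entire_with_coefs g A -> (fun s => g (cexp (- rc s))) @ +oo --> A 0%N.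
Proof.
move=> eg; rewrite (_ : (fun s => _) = (fun s => g (cexp (- rc s)) / cexp (- rc s) ^+ 0)); last first.
  by apply/funext => s; rewrite expr0 divr1.
apply: (@pseries_leading_coef (CC R) R +oo _ A) => //.
- exact: cvg_cexpN.
- by apply: nearW => s; exact: cexp_neq0.
- by apply: nearW => s; exact: eg.
Qed.

(** Cramer's rule: it writes a solution on a basis of solutions without any
    appeal to uniqueness for the initial value problem. *)
Lemma wronskian_cramer (R : realType) (w w1 w2 : CC R)
   (F F1 G G1 H H1 : CC R -> CC R) :
  (forall t, F t * G1 t - F1 t * G t = w) -> w != 0 ->
  (forall t, F t * H1 t - F1 t * H t = w1) ->
  (forall t, G t * H1 t - G1 t * H t = w2) ->
  forall t, H t = (- w2 / w) * F t + (w1 / w) * G t.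
Proof.
move=> ww w0 h1 h2 t; apply: (mulfI w0).
have -> : w * (- w2 / w * F t + w1 / w * G t) = - w2 * F t + w1 * G t by field.
by rewrite -(h1 t) -(h2 t) -(ww t); ring.
Qed.

(** Continuation around the origin multiplies the Wronskian, which is a
    constant, by mu nu. *)
Lemma wronskian_monodromy (R : realType) (m : nat) (a : 'rV[CC R]_m) (c mu nu : CC R)
    (F F1 G G1 : CC R -> CC R) :
  solves a F F1 -> solves a G G1 -> cexp c = 1 ->
  (forall t, F (t + c) = mu * F t) -> (forall t, G (t + c) = nu * G t) ->
  mu * nu != 1 -> forall t, F t * G1 t - F1 t * G t = 0.
Proof.
have mono (H H1 : CC R -> CC R) k : solves a H H1 -> cexp c = 1 ->
    (forall t, H (t + c) = k * H t) -> forall t, H1 (t + c) = k * H1 t.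
  move=> sH c1 Hc t.
  have s1 : solves a (fun t => H (t + c)) (fun t => H1 (t + c)).
    have := @solves_turn R m a c H H1; rewrite c1 expr1n dilate1 => /(_ erefl sH).
    by congr solves; apply/funext => u; rewrite mul1r.
  have E : (fun t => H (t + c)) = (fun t => k * H t) by apply/funext => u; rewrite Hc.
  rewrite E in s1; exact: (congr1 (fun f => f t) (solves_unique s1 (solvesZ k sH))).
move=> sF sG c1 Fc Gc mn t.
have := wronskian_cst sF sG (t + c) t.
rewrite Fc Gc (mono _ _ _ sF c1 Fc) (mono _ _ _ sG c1 Gc) => E.
have : (mu * nu - 1) * (F t * G1 t - F1 t * G t) = 0.
  by rewrite mulrBl mul1r -{2}E; ring.
by move/eqP; rewrite mulf_eq0 subr_eq0 (negPf mn) /= => /eqP.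
Qed.

Lemma cexp_2ipi_int (R : realType) (z : int) : cexp (2 * Ci R * rc pi * z%:~R) = 1.
Proof.
case: z => n; first by rewrite mulrC cexpMn cexp_2ipi expr1n.
by rewrite NegzE mulrNz mulrN cexpN mulrC cexpMn cexp_2ipi expr1n invr1.
Qed.

(** After removal of the integral part of Re p, the modulus forces Im p = 0,
    and the fractional part x of Re p satisfies cos (2 pi x) = 1, that is
    sin (pi x) = 0 with 0 <= x < 1. *)
Lemma cexp_2ipi_eq1 (R : realType) (p : CC R) : cexp (2 * Ci R * rc pi * p) = 1 -> is_integer p.
Proof.
move=> E; pose n := Num.floor (CRe p); exists n.
pose x := CRe p - n%:~R; pose y := CIm p.
have nE : n%:~R = rc n%:~R :> CC R by rewrite /rc rmorph_int.
have /andP[x0 x1] : 0 <= x < 1.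
  by rewrite subr_ge0 ltrBlDl -intrD1 floor_itv.
have pE : p = n%:~R + (rc x + Ci R * rc y).
  by rewrite {1}(C_ReIm p) nE addrA -rcD; congr (rc _ + _); rewrite /x addrC subrK.
have {E}: cexp (rc (- (2 * pi * y)) + Ci R * rc (2 * pi * x)) = 1.
  have : cexp (2 * Ci R * rc pi * (rc x + Ci R * rc y)) = 1.
    have := cexpD (2 * Ci R * rc pi * n%:~R) (2 * Ci R * rc pi * (rc x + Ci R * rc y)).
    by rewrite -mulrDr -pE E cexp_2ipi_int mul1r.
  move=> <-; congr cexp; rewrite rcN !rcM rc_nat.
  have := CiM R; set I := Ci R => II.
  rewrite !mulrDr; have -> : 2 * I * rc pi * (I * rc y) = 2 * rc pi * rc y * (I * I) by ring.
  by rewrite II; ring.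
rewrite cexpD cexp_rc => E.
have y0 : y = 0.
  have := congr1 (fun z => `|z|) E.
  rewrite normrM norm_cexp /= normr1 rc_norm ger0_norm ?expR_ge0 //.
  rewrite mul0r mul1r subrr expR0 mulr1 => /(congr1 (@CRe R)) /= E1.
  have /expR_inj/eqP : expR (- (2 * pi * y)) = expR 0 by rewrite E1 expR0.
  rewrite oppr_eq0 !mulf_eq0 pnatr_eq0 /= (gt_eqF (pi_gt0 R)) /=.
  by move/eqP.
move: E; rewrite y0 mulr0 oppr0 expR0 mul1r cexp_i => /(congr1 (@CRe R)) /=.
have -> : 2 * pi * x = (pi * x) *+ 2 by ring.
rewrite cos_mulr2n => E.
have s0 : sin (pi * x) = 0.
  by apply/eqP; rewrite -sqrf_eq0; apply/eqP; have := cos2Dsin2 (pi * x); lra.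
suff x00 : x = 0 by rewrite pE x00 y0 mulr0 !addr0.
apply/eqP; rewrite eq_le x0 andbT leNgt; apply/negP => xgt.
have : 0 < sin (pi * x).
  apply: sin_gt0_pi; rewrite mulr_gt0 ?pi_gt0 //=.
  by rewrite gtr_pMr // pi_gt0.
by rewrite s0 ltxx.
Qed.

(** * The Wronskian of the fundamental system at the origin *)

Lemma cpow_shift (R : realType) (c t u : CC R) : cpow c (t + u) = cexp (c * u) * cpow c t.
Proof. by rewrite /cpow mulrDr cexpD mulrC. Qed.

Lemma not_pos_natural_opp (R : realType) (p : CC R) :
  ~ is_integer p \/ is_pos_natural p -> ~ is_pos_natural (- p).
Proof.
move=> H [n n0 pn]; case: H => [H|[k k0 pk]].
  by apply: H; exists (- n%:Z); rewrite -[p]opprK pn mulrNz.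
have : (k + n)%:R = 0 :> CC R by rewrite natrD -pn -pk subrr.
by move/eqP; rewrite pnatr_eq0 addn_eq0 -leqn0 leqNgt k0.
Qed.

Lemma not_integer_opp (R : realType) (p : CC R) : ~ is_integer p -> ~ is_integer (- p).
Proof. by move=> H [z pz]; apply: H; exists (- z); rewrite mulrNz -pz opprK. Qed.

(** The pointwise forms of the limits of products and sums, over [CC R]: the
    functions below are given by formulas, not as products of functions. *)
Lemma cvg_mul (R : realType) (T : Type) (F : set_system T) {FF : Filter F} (f g : T -> CC R) (a b : CC R) :
  f @ F --> a -> g @ F --> b -> (fun x => f x * g x) @ F --> a * b.
Proof. exact: cvgM. Qed.

Lemma cvg_add (R : realType) (T : Type) (F : set_system T) {FF : Filter F} (f g : T -> CC R) (a b : CC R) :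
  f @ F --> a -> g @ F --> b -> (fun x => f x + g x) @ F --> a + b.
Proof. exact: cvgD. Qed.

Lemma cvg_eq_unique (R : realType) (T : Type) (F : set_system T) {FF : ProperFilter F} (f g : T -> CC R) (a b : CC R) :
  f @ F --> a -> g @ F --> b -> f =1 g -> a = b.
Proof. by move=> fa gb /funext fg; rewrite fg in fa; exact: norm_cvg_unique fa gb. Qed.

Lemma cvg_div1 (R : realType) (T : Type) (F : set_system T) {FF : Filter F} (f g : T -> CC R) (a : CC R) :
  f @ F --> a -> g @ F --> (1 : CC R) -> (fun x => f x / g x) @ F --> a.
Proof.
move=> fa g1; rewrite -(mulr1 a) -[X in _ * X]invr1.
exact: (cvg_mul fa (cvgV (oner_neq0 (CC R)) g1)).
Qed.

Lemma cexp_natN (R : realType) (n : nat) (s : R) : cexp (n%:R * - rc s) = cexp (- rc s) ^+ n.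
Proof. exact: cexpMn. Qed.

Lemma cvg_cexpNX (R : realType) (n : nat) : (0 < n)%N ->
  (fun s : R => cexp (- rc s) ^+ n) @ +oo --> (0 : CC R).
Proof.
case: n => // n _; elim: n => [|n IH]; first by under eq_fun do rewrite expr1; exact: cvg_cexpN.
rewrite (_ : (fun s => _) = (fun s => cexp (- rc s) * cexp (- rc s) ^+ n.+1)).
  by rewrite -(mulr0 0); apply: cvg_mul IH; exact: cvg_cexpN.
by apply/funext => s; rewrite exprS.
Qed.

(** x^n ln x --> 0 for n > 0. *)
Lemma cvg_cexpNX_log (R : realType) (n : nat) : (0 < n)%N ->
  (fun s : R => cexp (n%:R * - rc s) * - rc s) @ +oo --> (0 : CC R).
Proof.
case: n => // n _; rewrite (_ : (fun s => _) = (fun s => - (cexp (- rc s) ^+ n * (rc s * cexp (- rc s))))).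
  rewrite -(oppr0 (CC R)); apply: cvgN.
  case: n => [|n].
    rewrite (_ : (fun s => _) = (fun s => (rc s * cexp (- rc s)))); first exact: cvg_mul_cexpN.
    by apply/funext => s; rewrite expr0 mul1r.
  rewrite -(mulr0 0); exact: (cvg_mul (@cvg_cexpNX R n.+1 isT) (@cvg_mul_cexpN R)).
by apply/funext => s; rewrite cexp_natN exprS; ring.
Qed.

(** Here x^p f2 / f1 --> 1. For p a positive integer the logarithmic term of f2
    contributes lambda x^p ln x --> 0, and for p not an integer it is absent. *)
Lemma wronskian_fundamental (R : realType) (m : nat)
    (f1 f2 : 'rV[CC R]_m.-1 -> CC R -> CC R -> CC R)
    (lambda : 'rV[CC R]_m.-1 -> CC R -> CC R) (a' : 'rV[CC R]_m.-1) (p : CC R) :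
  fundamental_system_at_origin f1 f2 lambda ->
  ~ is_integer p \/ is_pos_natural p ->
  forall t, f1 a' p t * dx (f2 a' p) t - dx (f1 a' p) t * f2 a' p t = - p.
Proof.
move=> [g1 [g2 hf]] hp t.
have [[s1 s2] f1E [A A0 eA] f2E [B eB [nonint posnat _]]] := hf a' p (not_pos_natural_opp hp).
have gA := cvg_entire0 eA; rewrite A0 in gA.
have gB := cvg_entire0 eB.
rewrite -[RHS]mulr1; apply: (wronskian_origin (solution_solves s1) (solution_solves s2) f1E gA).
have gn0 := near_neq0_of_cvg1 gA.
have E : \forall s \near +oo, cexp (p * - rc s) * (f2 a' p (- rc s) / f1 a' p (- rc s)) =
   lambda a' p * (cexp (p * - rc s) * - rc s) + g2 a' p (cexp (- rc s)) / g1 a' p (cexp (- rc s)).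
  apply: filterS gn0 => s g0; rewrite f2E f1E; set u := - rc s.
  have -> : sp p = sp (- p) + p by rewrite /sp; field.
  have -> : cpow (sp (- p) + p) u = cpow (sp (- p)) u * cexp (p * u).
    by rewrite {1}/cpow [X in cexp X]mulrDl cexpD.
  by field; rewrite g0 !cexp_neq0.
suff H : (fun s => lambda a' p * (cexp (p * - rc s) * - rc s) + g2 a' p (cexp (- rc s)) / g1 a' p (cexp (- rc s))) @ +oo --> (1 : CC R).
  by apply: cvg_trans H; apply: near_eq_cvg; apply: filterS E => s ->.
case: hp => [np|[n n0 pn]].
  have [l0 g2E] := nonint np.
  have B1 : B 0%N = 1.
    have [_ _ [A' A0' eA'] _ _] := hf a' (- p) (not_pos_natural_opp (or_introl (not_integer_opp np))).
    have gA' := cvg_entire0 eA'; rewrite A0' in gA'.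
    move: gB; rewrite (_ : (fun s => _) = (fun s => g1 a' (- p) (cexp (- rc s)))).
      by move=> gB; exact: norm_cvg_unique gB gA'.
    by apply/funext => s; rewrite g2E.
  rewrite B1 in gB.
  rewrite (_ : (fun s => _) = (fun s => g2 a' p (cexp (- rc s)) / g1 a' p (cexp (- rc s)))).
    exact: (cvg_div1 gB gA).
  by apply/funext => s; rewrite l0 mul0r add0r.
have [B0 _] := posnat n n0 pn; rewrite B0 in gB.
rewrite -[X in _ --> X](add0r 1); apply: cvgD; last exact: (cvg_div1 gB gA).
rewrite -(mulr0 (lambda a' p)); apply: cvg_mul; first exact: cvg_cst.
have H := @cvg_cexpNX_log R n n0; rewrite -pn in H; exact: H.
Qed.

Lemma entire_dilate (R : realType) (g : CC R -> CC R) (A : nat -> CC R) (w : CC R) :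
  entire_with_coefs g A -> entire_with_coefs (fun x => g (w * x)) (fun k => w ^+ k * A k).
Proof.
move=> eg x; have := eg (w * x).
by under eq_fun do rewrite exprMn mulrA [A _ * _]mulrC.
Qed.

Lemma cvg_norm_bound (R : realType) (T : Type) (F : set_system T) {FF : Filter F}
    (f : T -> CC R) (g : T -> R) (l : CC R) :
  (\forall x \near F, `|f x - l| <= rc (g x)) -> g @ F --> (0 : R) -> f @ F --> l.
Proof.
move=> fg g0; apply/cvgrPdist_le => e /rc_real_gt0 [d d0 ->].
move/cvgr0Pnorm_le : g0 => /(_ d d0) g0.
near=> x; rewrite distrC.
have H1 : `|f x - l| <= rc (g x) by near: x.
apply: le_trans H1 _; rewrite ler_rc; apply: le_trans (ler_norm _) _.
by near: x.
Unshelve. all: by end_near. Qed.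

(** * The fundamental system under rotation *)

Section AtOrigin.
Variables (R : realType) (m : nat) (m_gt0 : (0 < m)%N).
Variables (f1 f2 : 'rV[CC R]_m.-1 -> CC R -> CC R -> CC R).
Variable (lambda : 'rV[CC R]_m.-1 -> CC R -> CC R).
Hypothesis hf : fundamental_system_at_origin f1 f2 lambda.

Lemma f1_at_origin (a' : 'rV[CC R]_m.-1) (p : CC R) : ~ is_pos_natural (- p) ->
  exists2 g, (exists2 A, A 0%N = 1 & entire_with_coefs g A) &
    forall t, f1 a' p t = cpow (sp p) t * g (cexp t).
Proof.
by case: hf => g1 [g2 H] np; have [_ E eA _ _] := H a' p np; exists (g1 a' p).
Qed.

Lemma f1_solves (a' : 'rV[CC R]_m.-1) (p : CC R) : ~ is_pos_natural (- p) ->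
  solves (param a' p) (f1 a' p) (dx (f1 a' p)).
Proof. by case: hf => g1 [g2 H] np; have [[? _] _ _ _ _] := H a' p np; exact: solution_solves. Qed.

Lemma f2_solves (a' : 'rV[CC R]_m.-1) (p : CC R) : ~ is_pos_natural (- p) ->
  solves (param a' p) (f2 a' p) (dx (f2 a' p)).
Proof. by case: hf => g1 [g2 H] np; have [[_ ?] _ _ _ _] := H a' p np; exact: solution_solves. Qed.

Lemma f1_monodromy (a' : 'rV[CC R]_m.-1) (p : CC R) : ~ is_pos_natural (- p) -> forall t,
  f1 a' p (t + 2 * Ci R * rc pi) = cexp (sp p * (2 * Ci R * rc pi)) * f1 a' p t.
Proof.
move=> np t; have [g _ fE] := f1_at_origin a' np.
rewrite !fE cpow_shift [cexp (t + _)]cexpD cexp_2ipi [cexp t * 1]mulr1.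
by rewrite -[LHS]mulrA.
Qed.

Lemma cexp_2sp (p : CC R) : cexp (sp p * (2 * Ci R * rc pi)) ^+ 2 = cexp (2 * Ci R * rc pi * p).
Proof.
rewrite -cexpMn; have -> : 2%:R * (sp p * (2 * Ci R * rc pi)) = 2 * Ci R * rc pi * 1%:~R + 2 * Ci R * rc pi * p.
  by rewrite /sp; field.
by rewrite cexpD cexp_2ipi_int mul1r.
Qed.

Lemma opp_p_neq0 (p : CC R) : ~ is_integer p \/ is_pos_natural p -> - p != 0.
Proof.
move=> hp; rewrite oppr_eq0; apply/eqP => p0.
case: hp => [[]|[k k0 pk]]; first by exists 0; rewrite p0.
by move/eqP: pk; rewrite p0 eq_sym pnatr_eq0 => /eqP k00; rewrite k00 in k0.
Qed.

(** Let G be the rotated f1 divided by the expected factor. Both G and f1 are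
    x^(s(p)) times an entire function with value 1 at 0, so G / f1 --> 1. Their
    Wronskian vanishes: if p is not an integer, because continuation around 0
    multiplies it by e^(2 i pi p); if p is a positive integer, because
    x^p G / f1 --> 0. Expanding G on the basis (f1, f2) then shows that it is
    proportional to f1 -- the Wronskian alone would not suffice across the
    zeros of f1 -- and the factor is the limit 1 of the quotient. *)
Lemma f1_turn (a' : 'rV[CC R]_m.-1) (p : CC R) (n : nat) :
  ~ is_integer p \/ is_pos_natural p -> forall t,
  f1 (dilate (omega m n%:R) a') p (t + turn m n%:R) = omega m (n%:R * sp p) * f1 a' p t.
Proof.
move=> hp; have np := not_pos_natural_opp hp.
set w := omega m n%:R; have wm : w ^+ m = 1 by exact: omega_nat_root.
have [g [A A0 eA] fE] := f1_at_origin a' np.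
have [h [B B0 eB] hE] := f1_at_origin (dilate w a') np.
have s1 := f1_solves a' np; have s2 := f2_solves a' np.
set mu := omega m (n%:R * sp p).
have muE t : cpow (sp p) (t + turn m n%:R) = mu * cpow (sp p) t.
  by rewrite cpow_shift /mu omegaE; congr (cexp _ * _); rewrite /turn; ring.
have mu0 : mu != 0 by exact: omega_neq0.
pose G t := mu^-1 * f1 (dilate w a') p (t + turn m n%:R).
have GE t : G t = cpow (sp p) t * h (w * cexp t).
  by rewrite /G hE muE -!mulrA mulKf // cexpD [cexp t * _]mulrC.
have [G1 sG] : exists G1, solves (param a' p) G G1.
  have := f1_solves (dilate w a') np; rewrite -dilate_param // => H.
  have := @solves_turn R m (param a' p) (turn m n%:R) _ _ wm H.
  by move=> /(solvesZ mu^-1) H1; eexists; exact: H1.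
have gA := cvg_entire0 eA; rewrite A0 in gA.
have gB := cvg_entire0 (@entire_dilate _ _ _ w eB); rewrite expr0 mul1r B0 in gB.
have GF : (fun s => G (- rc s) / f1 a' p (- rc s)) @ +oo --> (1 : CC R).
  rewrite (_ : (fun s => _) = (fun s => h (w * cexp (- rc s)) / g (cexp (- rc s)))).
    exact: (cvg_div1 gB gA).
  by apply/funext => s; rewrite GE fE -mulf_div mulfV ?mul1r // cexp_neq0.
have W0 t : f1 a' p t * G1 t - dx (f1 a' p) t * G t = 0.
  case: hp => [nonint|[k k0 pk]].
    apply: (wronskian_monodromy s1 sG (cexp_2ipi R) (f1_monodromy a' np) (nu := cexp (sp p * (2 * Ci R * rc pi)))).
      move=> u; rewrite /G addrAC f1_monodromy // mulrCA //.
    rewrite -expr2 cexp_2sp; apply/eqP => /cexp_2ipi_eq1; exact: nonint.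
  rewrite -[RHS](mulr0 (- p)); apply: (wronskian_origin s1 sG fE gA).
  rewrite -(mul0r 1) pk; apply: cvg_mul; last by rewrite -pk; exact: GF.
  rewrite (_ : (fun s => _) = (fun s : R => cexp (- rc s) ^+ k)); first exact: cvg_cexpNX.
  by apply/funext => s; rewrite cexp_natN.
have p0 := opp_p_neq0 hp.
have [c Gc] : exists c, forall t, G t = c * f1 a' p t.
  have WW := wronskian_fundamental a' hf hp.
  have E := wronskian_cramer WW p0 W0 (wronskian_cst s2 sG ^~ 0).
  exists (- (f2 a' p 0 * G1 0 - dx (f2 a' p) 0 * G 0) / - p) => t.
  by rewrite E mul0r mul0r addr0.
have c1 : c = 1.
  suff H : (fun s => G (- rc s) / f1 a' p (- rc s)) @ +oo --> c by exact: norm_cvg_unique H GF.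
  apply: cvg_near_cst; apply: filterS (near_neq0_of_cvg1 gA) => s g0.
  by rewrite Gc fE mulfK // mulf_neq0 // cexp_neq0.
move=> t; have := Gc t; rewrite c1 mul1r /G => <-.
by rewrite mulVKf.
Qed.

(** Let G be the rotated f2 divided by omega^(n s(-p)); it is
    al f1 + be f2 for some constants. Dividing by x^(s(-p)) turns this into the
    relation [key] between entire functions of x, x^p and ln x. Its limit at 0
    gives be = 1; comparing it with its continuation around 0 identifies the
    coefficients of ln x, omega^(n p) lambda(omega^n . a') = lambda(a'). What
    remains says that the regular parts differ by ga x^p (1 + ...) with
    ga = al - lambda (2 i pi n / m); and ga, the coefficient of x^p in that
    difference, is 0 because both regular parts are normalised by having no
    x^p term. *)
Lemma f2_turn_nat (a' : 'rV[CC R]_m.-1) (p : CC R) (n : nat) : is_pos_natural p -> forall t,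
  f2 (dilate (omega m n%:R) a') p (t + turn m n%:R) =
  omega m (n%:R * sp (- p)) * (f2 a' p t + lambda a' p * turn m n%:R * f1 a' p t).
Proof.
move=> pnat; have hp : ~ is_integer p \/ is_pos_natural p by right.
have np := not_pos_natural_opp hp.
have [N N0 pN] := pnat.
set w := omega m n%:R; have wm : w ^+ m = 1 by exact: omega_nat_root.
have f1t := @f1_turn a' p n hp; rewrite -/w in f1t.
have s1 := f1_solves a' np; have s2 := f2_solves a' np; have s2' := f2_solves (dilate w a') np.
have f1p := f1_monodromy a' np.
have WW := wronskian_fundamental a' hf hp.
case: hf => g1 [g2 H].
have [_ f1E [A A0 eA] f2E [B eB [_ posB _]]] := H a' p np.
have [_ _ _ f2E' [B' eB' [_ posB' _]]] := H (dilate w a') p np.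
have [B0 BN] := posB N N0 pN; have [B0' BN'] := posB' N N0 pN.
set l := lambda a' p in f2E *; set l' := lambda (dilate w a') p in f2E'.
set h := g2 (dilate w a') p in f2E' eB'; set g := g2 a' p in f2E eB; set k := g1 a' p in f1E eA.
clear posB posB' H.
set tn := turn m n%:R in f1t *.
set nu := omega m (n%:R * sp (- p)); have nu0 : nu != 0 by exact: omega_neq0.
pose r := omega m (n%:R * p).
have muE : omega m (n%:R * sp p) = nu * r.
  by rewrite -omegaD -mulrDr; congr (omega _ (_ * _)); rewrite /sp; field.
rewrite muE in f1t.
pose G t := nu^-1 * f2 (dilate w a') p (t + tn).
have GE t : G t = r * l' * f1 a' p t * (t + tn) + cpow (sp (- p)) t * h (w * cexp t).
  rewrite /G f2E' f1t cexpD [cexp t * _]mulrC -/w.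
  have -> : cpow (sp (- p)) (t + tn) = nu * cpow (sp (- p)) t.
    by rewrite cpow_shift /nu omegaE; congr (cexp _ * _); rewrite /tn /turn; ring.
  by rewrite -/w; field.
have [G1 sG] : exists G1, solves (param a' p) G G1.
  rewrite -dilate_param // in s2'.
  have := @solves_turn R m (param a' p) tn _ _ wm s2'.
  by move=> /(solvesZ nu^-1) H1; eexists; exact: H1.
have [al [be Gc]] : exists al be, forall t, G t = al * f1 a' p t + be * f2 a' p t.
  have E := wronskian_cramer WW (opp_p_neq0 hp) (wronskian_cst s1 sG ^~ 0) (wronskian_cst s2 sG ^~ 0).
  by eexists; eexists; exact: E.
have kA := cvg_entire0 eA; rewrite A0 in kA.
have gB := cvg_entire0 eB; rewrite B0 in gB.
have hB := cvg_entire0 (@entire_dilate _ _ _ w eB'); rewrite expr0 mul1r B0' in hB.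
have spE t : cpow (sp p) t = cpow (sp (- p)) t * cexp t ^+ N.
  by rewrite -cexpMn -pN {1}/cpow -cexpD; congr cexp; rewrite /sp; field.
have dec := @cvg_cexpNX R N N0.
have dect : (fun s : R => cexp (- rc s) ^+ N * - rc s) @ +oo --> (0 : CC R).
  by rewrite (_ : (fun s => _) = (fun s : R => cexp (N%:R * - rc s) * - rc s));
    [exact: cvg_cexpNX_log | apply/funext => s; rewrite cexp_natN].
have key t : r * l' * (cexp t ^+ N * k (cexp t)) * (t + tn) + h (w * cexp t) =
  al * (cexp t ^+ N * k (cexp t)) + be * (l * (cexp t ^+ N * k (cexp t)) * t + g (cexp t)).
  apply: (mulfI (cexp_neq0 (sp (- p) * t))); rewrite -/(cpow (sp (- p)) t).
  by have := Gc t; rewrite GE f2E !f1E spE => E; apply: (etrans _ (etrans E _)); ring.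
have dk : (fun s : R => cexp (- rc s) ^+ N * k (cexp (- rc s))) @ +oo --> (0 : CC R).
  by rewrite -(mul0r 1); exact: (cvg_mul dec kA).
have dkt : (fun s : R => cexp (- rc s) ^+ N * - rc s * k (cexp (- rc s))) @ +oo --> (0 : CC R).
  by rewrite -(mul0r 1); exact: (cvg_mul dect kA).
have cstM (c : CC R) (f : R -> CC R) : f @ +oo --> (0 : CC R) -> (fun s => c * f s) @ +oo --> (0 : CC R).
  by move=> f0; rewrite -(mulr0 c); exact: (cvg_mul (cvg_cst c) f0).
have be1 : be = 1.
  have L1 : (fun s : R => r * l' * (cexp (- rc s) ^+ N * - rc s * k (cexp (- rc s))) +
      r * l' * tn * (cexp (- rc s) ^+ N * k (cexp (- rc s))) + h (w * cexp (- rc s))) @ +oo --> 0 + 0 + (1 : CC R).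
    exact: (cvg_add (cvg_add (cstM _ _ dkt) (cstM _ _ dk)) hB).
  have L2 : (fun s : R => al * (cexp (- rc s) ^+ N * k (cexp (- rc s))) +
      be * l * (cexp (- rc s) ^+ N * - rc s * k (cexp (- rc s))) + be * g (cexp (- rc s))) @ +oo --> 0 + 0 + be * 1.
    exact: (cvg_add (cvg_add (cstM _ _ dk) (cstM _ _ dkt)) (cvg_mul (cvg_cst be) gB)).
  rewrite !add0r in L1; rewrite !add0r mulr1 in L2.
  apply/esym/(cvg_eq_unique L1 L2) => s; have := key (- rc s); set x := cexp _ => E.
  by apply: (etrans _ (etrans E _)); ring.
have [t0 ft0] : exists t, f1 a' p t != 0.
  have [s k0] := filter_ex (near_neq0_of_cvg1 kA).
  by exists (- rc s); rewrite f1E mulf_neq0 // cexp_neq0.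
(* only the factors t change under t |-> t + 2 i pi: the difference of the two
   instances of [key] is 2 i pi times the difference of the log coefficients *)
have rl : r * l' = l.
  have tp : 2 * Ci R * rc pi != 0.
    by rewrite !mulf_neq0 ?pnatr_eq0 ?Ci_neq0 // -[0]/(rc 0) (inj_eq (@complexI R)) gt_eqF // pi_gt0.
  set M := cexp (sp p * (2 * Ci R * rc pi)) in f1p.
  have xp t : cexp (t + 2 * Ci R * rc pi) = cexp t by rewrite cexpD cexp_2ipi mulr1.
  have := congr2 (fun u v => u - v) (key (t0 + 2 * Ci R * rc pi)) (key t0).
  rewrite /= !xp be1 => /eqP; rewrite -subr_eq0 => /eqP kk.
  have : (r * l' - l) * (cexp t0 ^+ N * k (cexp t0)) * (2 * Ci R * rc pi) = 0.
    by apply: etrans _ kk; ring.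
  move/eqP; rewrite mulf_eq0 (negPf tp) orbF mulf_eq0 => /orP[|xk].
    by rewrite subr_eq0 => /eqP.
  by move: ft0; rewrite f1E spE -mulrA (eqP xk) mulr0 eqxx.
pose ga := al - l * tn.
have dE s : h (w * cexp (- rc s)) - g (cexp (- rc s)) = ga * (cexp (- rc s) ^+ N * k (cexp (- rc s))).
  have := key (- rc s); set x := cexp _.
  rewrite be1 rl mul1r => /eqP; rewrite -subr_eq0 => /eqP kk.
  apply/eqP; rewrite -subr_eq0; apply/eqP; apply: etrans _ kk; rewrite /ga; ring.
pose C j := w ^+ j * B' j - B j.
have serC : \forall s \near +oo, series (fun j => C j * cexp (- rc s) ^+ j) @ \oo -->
    ga * (cexp (- rc s) ^+ N * k (cexp (- rc s))).
  apply: nearW => s; rewrite -dE.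
  have H1 := @entire_dilate _ _ _ w eB' (cexp (- rc s)); have H2 := eB (cexp (- rc s)).
  have -> : (fun j => C j * cexp (- rc s) ^+ j) =
    (fun j => w ^+ j * B' j * cexp (- rc s) ^+ j) - (fun j => B j * cexp (- rc s) ^+ j).
    by apply/funext => j; rewrite /C mulrBl.
  have -> : series ((fun j => w ^+ j * B' j * cexp (- rc s) ^+ j) - (fun j => B j * cexp (- rc s) ^+ j)) =
    series (fun j => w ^+ j * B' j * cexp (- rc s) ^+ j) - series (fun j => B j * cexp (- rc s) ^+ j).
    by apply/funext => M; rewrite /series /= sumrB.
  exact: (cvgB H1 H2).
have en0 : \forall s \near +oo, cexp (- rc s) != 0 :> CC R by apply: nearW => s; exact: cexp_neq0.
have lead j : (j <= N)%N -> (forall i, (i < j)%N -> C i = 0) ->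
    (fun s : R => ga * (cexp (- rc s) ^+ (N - j) * k (cexp (- rc s)))) @ +oo --> C j.
  move=> jN C0; have H := pseries_leading_coef (@cvg_cexpN R) en0 serC C0.
  rewrite (_ : (fun s => _) = (fun s : R => ga * (cexp (- rc s) ^+ N * k (cexp (- rc s))) / cexp (- rc s) ^+ j)).
    exact: H.
  apply/funext => s; rewrite -{2}(subnK jN) exprD; field.
  by rewrite expf_neq0 // cexp_neq0.
(* the difference of the regular parts is ga x^N (1 + ...), so its coefficients
   below N vanish and the one of index N is ga *)
have C0 j : (j < N)%N -> C j = 0.
  elim/ltn_ind: j => j IH jN.
  have H := lead j (ltnW jN) (fun i ij => IH i ij (ltn_trans ij jN)).
  apply: norm_cvg_unique H _; apply: cstM.
  rewrite -(mul0r 1); apply: (cvg_mul _ kA); apply: cvg_cexpNX; by rewrite subn_gt0.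
have ga0 : ga = 0.
  have H := lead N (leqnn N) C0; rewrite subnn /C BN BN' mulr0 subrr in H.
  have H2 : (fun s : R => ga * (cexp (- rc s) ^+ 0 * k (cexp (- rc s)))) @ +oo --> ga * (1 * 1).
    apply: (cvg_mul (cvg_cst ga)); apply: (cvg_mul _ kA).
    by rewrite (_ : (fun s => _) = fun=> 1); [exact: cvg_cst|apply/funext => s; rewrite expr0].
  by rewrite !mulr1 in H2; exact: norm_cvg_unique H2 H.
move=> t; have := Gc t; rewrite be1 mul1r /G => E.
rewrite -[LHS](mulVKf nu0) E; congr (_ * _); rewrite addrC; congr (_ + _ * _).
by apply/eqP; rewrite -subr_eq0; apply/eqP.
Qed.

Lemma nonint_lambda0 (a' : 'rV[CC R]_m.-1) (p : CC R) : ~ is_integer p -> lambda a' p = 0.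
Proof.
move=> np; case: hf => g1 [g2 H].
have [_ _ _ _ [B _ [nonint _ _]]] := H a' p (not_pos_natural_opp (or_introl np)).
by have [] := nonint np.
Qed.

Lemma nonint_f2E (a' : 'rV[CC R]_m.-1) (p : CC R) : ~ is_integer p -> f2 a' p = f1 a' (- p).
Proof.
move=> np; apply/funext => t; case: hf => g1 [g2 H].
have [_ _ _ f2E [B _ [nonint _ _]]] := H a' p (not_pos_natural_opp (or_introl np)).
have [_ f1E _ _ _] := H a' (- p) (not_pos_natural_opp (or_introl (not_integer_opp np))).
have [l0 g2E] := nonint np.
by rewrite f2E f1E l0 g2E !mul0r add0r.
Qed.

(** If p is not an integer, f2 is f1 for the exponent - p and has no
    logarithm. *)
Lemma f2_turn (a' : 'rV[CC R]_m.-1) (p : CC R) (n : nat) :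
  ~ is_integer p \/ is_pos_natural p -> forall t,
  f2 (dilate (omega m n%:R) a') p (t + turn m n%:R) =
  omega m (n%:R * sp (- p)) * (f2 a' p t + lambda a' p * turn m n%:R * f1 a' p t).
Proof.
case=> [np|]; last exact: f2_turn_nat.
move=> t; rewrite nonint_lambda0 // !mul0r addr0 !nonint_f2E //.
by apply: f1_turn; left; exact: not_integer_opp.
Qed.

End AtOrigin.

(** * Formal data at infinity *)

Lemma cpow_sub_nat (R : realType) (m k : nat) (t : CC R) :
  cpow (m%:R / 2 - k%:R - 1) t = cpow (m%:R / 2 - 1) t * cexp (- t) ^+ k.
Proof. by rewrite -cexpMn {1}/cpow -cexpD; congr cexp; ring. Qed.

(** On the positive real axis an expansion is a power series in y = 1 / x, once
    the leading power x^(m/2 - 1) is factored out. *)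
Lemma sqrt_expansion_pseries (R : realType) (m : nat) (a : 'rV[CC R]_m) (c : nat -> CC R) :
  sqrt_expansion a c -> exists2 d : R -> CC R,
    \forall s \near +oo, series (fun k => c k * cexp (- rc s) ^+ k) @ \oo --> d s &
    \forall s \near +oo, d s ^+ 2 =
       Pm a (cexp (rc s)) / (cexp (rc s) * cpow (m%:R / 2 - 1) (rc s)) ^+ 2.
Proof.
move=> [c0 [rho H]].
have {}H (s : R) : rho < s -> exists d : CC R,
    (series (fun k => c k * cexp (- rc s) ^+ k) @ \oo --> d) /\
    d ^+ 2 = Pm a (cexp (rc s)) / (cexp (rc s) * cpow (m%:R / 2 - 1) (rc s)) ^+ 2.
  move=> rs; have [w w2 wc] := H (rc s) rs.
  set e := cpow (m%:R / 2 - 1) (rc s); have e0 : e != 0 by exact: cexp_neq0.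
  exists (e^-1 * (w / cexp (rc s))); split; last first.
    by rewrite -w2; field; rewrite e0 cexp_neq0.
  have -> : series (fun k => c k * cexp (- rc s) ^+ k) =
    (fun N => e^-1 * series (fun k => c k * cpow (m%:R / 2 - k%:R - 1) (rc s)) N).
    apply/funext => N; rewrite /series /= big_distrr /=; apply: eq_bigr => k _.
    by rewrite cpow_sub_nat -/e; field.
  exact: (cvg_mul (cvg_cst e^-1) wc).
have {}H : forall s : R, exists d : CC R, rho < s ->
    (series (fun k => c k * cexp (- rc s) ^+ k) @ \oo --> d) /\
    d ^+ 2 = Pm a (cexp (rc s)) / (cexp (rc s) * cpow (m%:R / 2 - 1) (rc s)) ^+ 2.
  move=> s; have [rs|rs] := ltP rho s; last by exists 0.
  by have [d Hd] := H s rs; exists d.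
have [d Hd] := choice H; exists d; near=> s; apply Hd; near: s; apply: nbhs_pinfty_gt; exact: num_real.
Unshelve. all: by end_near. Qed.

(** The sums d and d' of two expansions have the same square, and both tend to
    1, so d + d' does not vanish near infinity and d = d' there; power series
    with the same sums have the same coefficients. *)
Lemma sqrt_expansion_unique (R : realType) (m : nat) (a : 'rV[CC R]_m) (c c' : nat -> CC R) :
  sqrt_expansion a c -> sqrt_expansion a c' -> c =1 c'.
Proof.
move=> sc sc'; have [c0 c0'] := (sc.1, sc'.1).
have [d Hd d2] := sqrt_expansion_pseries sc.
have [d' Hd' d2'] := sqrt_expansion_pseries sc'.
have en0 : \forall s \near +oo, cexp (- rc s) != 0 :> CC R by apply: nearW => s; exact: cexp_neq0.
have lim0 (e : nat -> CC R) (f : R -> CC R) : e 0%N = 1 ->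
   (\forall s \near +oo, series (fun k => e k * cexp (- rc s) ^+ k) @ \oo --> f s) ->
   f @ +oo --> (1 : CC R).
  move=> e0 He; rewrite -e0.
  have H := @pseries_leading_coef (CC R) R +oo _ e _ f 0 (@cvg_cexpN R) en0 He (fun j => ltac:(by [])).
  rewrite (_ : f = (fun s => f s / cexp (- rc s) ^+ 0)); first exact: H.
  by apply/funext => s; rewrite expr0 divr1.
have d1 := lim0 _ _ c0 Hd; have d1' := lim0 _ _ c0' Hd'.
have sum2 : (fun s => d s + d' s) @ +oo --> (1 + 1 : CC R) by exact: cvg_add.
have n0 : \forall s \near +oo, d s + d' s != 0.
  by apply: cvgr_neq0 sum2 _; rewrite -[1 + 1]/(2%:R) pnatr_eq0.
apply: (@pseries_coef_unique (CC R) R +oo _ c c' _ d (@cvg_cexpN R) en0 Hd).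
near=> s; suff -> : d s = d' s by near: s.
have E : d s ^+ 2 = d' s ^+ 2.
  transitivity (Pm a (cexp (rc s)) / (cexp (rc s) * cpow (m%:R / 2 - 1) (rc s)) ^+ 2).
    by near: s.
  by apply/esym; near: s.
have dn : d s + d' s != 0 by near: s.
by move/eqP: E; rewrite eqf_sqr => /orP[/eqP //|/eqP E]; rewrite E addNr eqxx in dn.
Unshelve. all: by end_near. Qed.

Lemma CRe_imag (R : realType) (x : R) : CRe (Ci R * rc x) = 0.
Proof. by rewrite /= mul0r mul1r subrr. Qed.

Lemma CIm_imag (R : realType) (x : R) : CIm (Ci R * rc x) = x.
Proof. by rewrite /= mul0r mul1r add0r. Qed.

Lemma turnN1E (R : realType) (m : nat) : turn m (-1) = Ci R * rc (- (2 * pi / m%:R)).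
Proof. by rewrite /turn rcN !rcM rcV !rc_nat; ring. Qed.

(** Rotation by omega^(-1) changes the sign of x^(m/2): it exchanges the two
    determinations of the square root of P_m, hence the exponentials e^S and
    e^(-S). *)
Lemma cexp_half_turn (R : realType) (m : nat) : (0 < m)%N -> cexp (m%:R / 2 * turn m (-1)) = -1 :> CC R.
Proof.
move=> m0; have -> : m%:R / 2 * turn m (-1) = - (Ci R * rc pi).
  by rewrite /turn; field; rewrite ?pnatr_eq0 -?lt0n.
by rewrite cexpN cexp_ipi invrN invr1.
Qed.

Lemma cexp_half_turnB (R : realType) (m k : nat) (c : CC R) : (0 < m)%N ->
  cexp ((m%:R / 2 - k%:R - c) * turn m (-1)) =
  - cexp (turn m (-1)) ^- k * cexp (- (c * turn m (-1))) :> CC R.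
Proof.
move=> m0; have -> : (m%:R / 2 - k%:R - c) * turn m (-1) =
  m%:R / 2 * turn m (-1) - k%:R * turn m (-1) - c * turn m (-1) by ring.
by rewrite !cexpD cexp_half_turn // cexpN cexpMn mulN1r.
Qed.

Section AtInfinity.
Variables (R : realType) (m : nat) (m_gt0 : (0 < m)%N).
Variable b : 'rV[CC R]_m -> nat -> CC R.
Hypothesis hb : forall a : 'rV[CC R]_m, sqrt_expansion a (b a).
Local Notation w := (omega m (-1) : CC R).
Local Notation eta := (turn m (-1) : CC R).

Lemma omegaN1_root : w ^+ m = 1.
Proof. by rewrite omegaN exprVn -[1]/(1%:R) omega_nat_root // invr1. Qed.

(** Transporting the expansion of the square root at omega^(-1) x to x; the
    root changes sign, which restores the leading coefficient 1. *)
Lemma sqrt_expansion_turn (a : 'rV[CC R]_m) (c : nat -> CC R) :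
  sqrt_expansion (dilate w a) c -> sqrt_expansion a (fun k => w ^- k * c k).
Proof.
move=> [c0 [rho H]]; split; first by rewrite expr0 invr1 mul1r.
exists rho => t rt.
have [|z z2 zc] := H (t + eta); first by rewrite CRe_add turnN1E CRe_imag addr0.
have w0 : w != 0 by exact: omega_neq0.
have tw : cexp (t + eta) = w * cexp t by rewrite cexpD mulrC.
exists (- z); first by rewrite sqrrN z2 tw; apply: Pm_dilate; exact: omegaN1_root.
have -> : series (fun k => w ^- k * c k * cpow (m%:R / 2 - k%:R - 1) t) =
   (fun N => - w * series (fun k => c k * cpow (m%:R / 2 - k%:R - 1) (t + eta)) N).
  apply/funext => N; rewrite /series /= big_distrr /=; apply: eq_bigr => k _.
  rewrite cpow_shift cexp_half_turnB // mul1r cexpN -omegaE.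
  by field; rewrite expf_neq0 // w0.
have -> : - z / cexp t = - w * (z / cexp (t + eta)).
  by rewrite tw; field; rewrite w0 cexp_neq0.
exact: (cvg_mul (cvg_cst (- w)) zc).
Qed.

Lemma b_turn (a : 'rV[CC R]_m) (k : nat) : b (dilate w a) k = w ^+ k * b a k.
Proof.
have H := sqrt_expansion_unique (sqrt_expansion_turn (hb (dilate w a))) (hb a) k.
by rewrite -H mulVKf // expf_neq0 // omega_neq0.
Qed.

(** For m even, b_0 is multiplied by (omega^(-1))^(m/2) = - 1 and cancels. *)
Lemma rexp_turn (a : 'rV[CC R]_m) : rexp b (dilate w a) + rexp b a = 1 - m%:R / 2.
Proof.
rewrite /rexp b_turn; case: ifP => [_|/negbT mo]; first by field.
have hm : m%:R / 2 = (m./2)%:R :> CC R.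
  have -> : m%:R = (m./2 * 2)%:R :> CC R by rewrite muln2 even_halfK.
  by rewrite natrM mulfK // pnatr_eq0.
have wm2 : w ^+ m./2 = -1.
  by have := @cexp_half_turn R m m_gt0; rewrite hm cexpMn.
by rewrite wm2; field.
Qed.

Lemma Sexp_turn (a : 'rV[CC R]_m) (t : CC R) :
  Sexp b (dilate w a) (t + eta) = - Sexp b a t.
Proof.
rewrite /Sexp opprD; congr (_ + _).
  by rewrite cpow_shift cexp_half_turn //; ring.
rewrite -sumrN; apply: eq_bigr => k _.
rewrite b_turn cpow_shift; have := @cexp_half_turnB R m k 0 m_gt0.
rewrite subr0 mul0r oppr0 cexp0 mulr1 => ->.
rewrite -omegaE; have := expf_neq0 k (omega_neq0 m (-1 : CC R)).
set x := w ^+ k => x0; set y := _^-1; set z := cpow _ _; set u := b a k.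
by rewrite -/x; field.
Qed.

Lemma has_derivative_sum (r : seq nat) (P : pred nat) (F : nat -> CC R -> CC R) (d : nat -> CC R) (t : CC R) :
  (forall k, has_derivative (F k) t (d k)) ->
  has_derivative (fun t => \sum_(k <- r | P k) F k t) t (\sum_(k <- r | P k) d k).
Proof.
move=> H; elim: r => [|k r IH].
  rewrite big_nil; apply: has_derivative_eq (has_derivative_cst 0 t) _ _ => // u.
  by rewrite big_nil.
rewrite big_cons; case: (boolP (P k)) => Pk.
  by apply: has_derivative_eq (has_derivativeD (H k) IH) _ _ => // u; rewrite big_cons Pk.
by apply: has_derivative_eq IH _ _ => // u; rewrite big_cons (negPf Pk).
Qed.

Lemma cvg_sum0 (r : seq nat) (P : pred nat) (f : nat -> R -> CC R) :
  (forall k, k \in r -> f k @ +oo --> (0 : CC R)) ->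
  (fun s => \sum_(k <- r | P k) f k s) @ +oo --> (0 : CC R).
Proof.
elim: r => [|k r IH] H.
  by rewrite (_ : (fun s => _) = fun=> 0); [exact: cvg_cst|apply/funext => s; rewrite big_nil].
have {}IH := IH (fun j jr => H j (mem_behead (jr : j \in behead (k :: r)))).
rewrite (_ : (fun s => _) = (fun s => (if P k then f k s else 0) + \sum_(k <- r | P k) f k s)); last first.
  by apply/funext => s; rewrite big_cons; case: ifP; rewrite ?add0r.
have H0 : (fun s => if P k then f k s else 0) @ +oo --> (0 : CC R).
  by case: (P k); [apply: H; exact: mem_head|exact: cvg_cst].
by have := cvg_add H0 IH; rewrite addr0; exact.
Qed.

(** dS/dt, where t = ln x. *)
Definition dSexp (a : 'rV[CC R]_m) (t : CC R) : CC R :=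
  2 / m%:R * (m%:R / 2 * cpow (m%:R / 2) t) +
  \sum_(1 <= k < m | (k.*2 < m)%N)
    b a k / (m%:R / 2 - k%:R) * ((m%:R / 2 - k%:R) * cpow (m%:R / 2 - k%:R) t).

Lemma has_derivative_Sexp (a : 'rV[CC R]_m) (t : CC R) :
  has_derivative (Sexp b a) t (dSexp a t).
Proof.
apply: has_derivativeD; first exact: has_derivativeZ (is_derive_cexpM _ _).
by apply: has_derivative_sum => k; exact: has_derivativeZ (is_derive_cexpM _ _).
Qed.

Lemma cvg_dSexp (a : 'rV[CC R]_m) :
  (fun s => cexp (- (m%:R / 2 * rc s)) * dSexp a (rc s)) @ +oo --> (1 : CC R).
Proof.
have mn0 : m%:R != 0 :> CC R by rewrite pnatr_eq0 -lt0n.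
rewrite (_ : (fun s => _) = (fun s : R => 1 + \sum_(1 <= k < m | (k.*2 < m)%N)
    b a k / (m%:R / 2 - k%:R) * (m%:R / 2 - k%:R) * cexp (- rc s) ^+ k)); last first.
  apply/funext => s; rewrite /dSexp mulrDr; congr (_ + _).
    rewrite cexpN /cpow; field.
    by rewrite mn0 cexp_neq0.
  rewrite big_distrr /=; apply: eq_bigr => k _.
  have -> : cpow (m%:R / 2 - k%:R) (rc s) = cexp (m%:R / 2 * rc s) * cexp (- rc s) ^+ k.
    by rewrite -cexpMn {1}/cpow -cexpD; congr cexp; ring.
  have E : cexp (- (m%:R / 2 * rc s)) * cexp (m%:R / 2 * rc s) = 1 by rewrite -cexpD addNr cexp0.
  move: (m%:R / 2) E => y E; set e := cexp (- rc s) ^+ k.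
  transitivity (b a k / (y - k%:R) * (y - k%:R) * e * (cexp (- (y * rc s)) * cexp (y * rc s))).
    by move: (_^-1) => z; ring.
  by rewrite E mulr1.
rewrite -[X in _ --> X]addr0; apply: cvg_add; first exact: cvg_cst.
apply: cvg_sum0 => k; rewrite mem_index_iota => /andP[k1 _].
rewrite -(mulr0 (b a k / (m%:R / 2 - k%:R) * (m%:R / 2 - k%:R))).
exact: (cvg_mul (cvg_cst _) (@cvg_cexpNX R k k1)).
Qed.

(** * Neighbouring solutions at infinity *)

Variable Phi0 : 'rV[CC R]_m -> CC R -> CC R.
Hypothesis hPhi0 : canonical_at_infinity b Phi0.

(** The order 1 truncation of the asymptotic expansion, along the ray
    arg x = th of the sector. *)
Lemma cvg_Phi0 (a : 'rV[CC R]_m) (th : R) : `|th| < 3 * pi / m%:R ->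
  (fun s => let t := rc s + Ci R * rc th in
     Phi0 a t / (cpow (rexp b a) t * cexp (- Sexp b a t))) @ +oo --> (1 : CC R).
Proof.
rewrite ltr_norml => /andP[th1 th2].
have [_ [q [q0 H]] _] := hPhi0.
have [K [rho /nbhs_singleton {}H]] := H a th th 1%N th1 th2.
have st : 0 < step R m by rewrite /step; case: ifP.
have H0 : (fun s => K * expR (- (1%:R * step R m * s))) @ +oo --> (0 : R).
  rewrite -(mulr0 K); apply: cvgMl_tmp.
  by apply: cvg_expRNM; rewrite mul1r.
apply: (cvg_norm_bound _ H0); near=> s.
have rs : rho < s by near: s; apply: nbhs_pinfty_gt; exact: num_real.
have := H (rc s + Ci R * rc th).
rewrite CRe_add CRe_imag addr0 CIm_add CIm_imag add0r => /(_ rs).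
rewrite lexx => /(_ isT).
by rewrite big_ord_recl big_ord0 addr0 q0 mul1r /= mul0r oppr0 /cpow mul0r cexp0.
Unshelve. all: by end_near. Qed.

(** On the positive real axis u is equivalent to x^(ru) e^(-S), and v to
    C x^(rv) e^S with C = omega^(-rv): v is Phi_0 on the ray
    arg x = - 2 pi / m, which is inside the sector of half-opening 3 pi / m,
    and there S has the opposite sign. Hence
    h = x^(ru - rv) e^(-2 S) v / u tends to C. As ru + rv = 1 - m / 2, its
    derivative in t = ln x is (ru - rv - 2 dS/dt) h - x^(m/2) W / Uh^2, with Uh
    the quotient of u by its equivalent. Multiplied by x^(-m/2) it tends to
    - 2 C - W, which must be 0; and - 2 C = 2 omega^(ru - 1). *)
Lemma stokes_wronskian (a : 'rV[CC R]_m) (U1 V1 : CC R -> CC R) :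
  let u := Phi0 a in let v := fun t => Phi0 (dilate w a) (t + eta) in
  solves a u U1 -> solves a v V1 ->
  forall t, v t * U1 t - V1 t * u t = 2 * omega m (rexp b a - 1).
Proof.
move=> u v su sv t0; set W := LHS.
have WE t : v t * U1 t - V1 t * u t = W by exact: wronskian_cst sv su t t0.
have [[du _] [dv _]] := (su, sv).
have mR : 0 < m%:R :> R by rewrite ltr0n.
have pim : 0 < pi / m%:R :> R by rewrite divr_gt0 // pi_gt0.
set ru := rexp b a; set rv := rexp b (dilate w a).
have rE : rv = 1 - m%:R / 2 - ru by rewrite -(rexp_turn a) addrK.
(* u and v divided by their equivalents; the factor C is part of the power of
   the shifted variable *)
pose Uh t := u t / (cpow ru t * cexp (- Sexp b a t)).
pose Vh t := v t / (cpow rv (t + eta) * cexp (Sexp b a t)).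
have Uh1 : (fun s => Uh (rc s)) @ +oo --> (1 : CC R).
  have := @cvg_Phi0 a 0; rewrite normr0 -mulrA => /(_ _)/wrap[]; first by rewrite mulr_gt0.
  by rewrite /=; under eq_fun do rewrite mulr0 addr0.
have Vh1 : (fun s => Vh (rc s)) @ +oo --> (1 : CC R).
  have := @cvg_Phi0 (dilate w a) (- (2 * pi / m%:R)).
  rewrite normrN ger0_norm; last by rewrite -mulrA mulr_ge0 // ltW.
  rewrite -!mulrA ltr_pM2r // => /(_ _)/wrap[]; first by rewrite ltr_nat.
  rewrite /=; under eq_fun do rewrite mulrA -turnN1E Sexp_turn // opprK.
  exact.
pose C := cexp (rv * eta).
have uE t : u t = cexp (ru * t) * cexp (- Sexp b a t) * Uh t.
  by rewrite /Uh mulrC divfK // mulf_neq0 // cexp_neq0.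
have vE t : v t = C * cexp (rv * t) * cexp (Sexp b a t) * Vh t.
  by rewrite /Vh cpow_shift -/C mulrC divfK // !mulf_neq0 // cexp_neq0.
pose h t := cexp ((ru - rv) * t - 2 * Sexp b a t) * (v t / u t).
pose D t := (ru - rv - 2 * dSexp a t) * h t - cexp (m%:R / 2 * t) * W / Uh t ^+ 2.
have Un0 := near_neq0_of_cvg1 Uh1.
have C0 : C != 0 by exact: cexp_neq0.
have hE t : Uh t != 0 -> h t = C * (Vh t / Uh t).
  move=> U0; rewrite /h vE uE cexpD mulrBl cexpD !cexpN.
  have -> : cexp (2 * Sexp b a t) = cexp (Sexp b a t) ^+ 2 by rewrite cexpMn.
  by field; rewrite U0 !cexp_neq0.
have h1 : (fun s => h (rc s)) @ +oo --> C.
  have H : (fun s => C * (Vh (rc s) / Uh (rc s))) @ +oo --> C * 1.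
    exact: (cvg_mul (cvg_cst C) (cvg_div1 Vh1 Uh1)).
  rewrite mulr1 in H; apply: cvg_trans H; apply: near_eq_cvg.
  by apply: filterS Un0 => s /hE ->.
pose k (s : R) : R := expR (- (m%:R / 2 * s)).
have kE s : rc (k s) = cexp (- (m%:R / 2 * rc s)).
  by rewrite -(rc_nat R m) -(rc_nat R 2) -rcV -!rcM -rcN cexp_rc.
suff : - 2 * C - W = 0.
  move=> /eqP; rewrite subr_eq0 => /eqP <-.
  rewrite /C rE mulNr -mulrN; congr (_ * _).
  have -> : (1 - m%:R / 2 - ru) * eta = m%:R / 2 * eta * (-1) + turn m (ru - 1).
    by rewrite /turn; ring.
  by rewrite cexpD mulrN1 cexpN cexp_half_turn // invrN invr1 mulN1r opprK.
refine (@scaled_derivative_lim0 R h D k C _ _ _ h1 _).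
- apply: filterS Un0 => s U0; set t := rc s in U0 *.
  have u0 : u t != 0.
    by rewrite uE; apply: mulf_neq0 U0; apply: mulf_neq0; exact: cexp_neq0.
  have dE : has_derivative (fun t => (ru - rv) * t - 2 * Sexp b a t) t ((ru - rv) * 1 - 2 * dSexp a t).
    by apply: has_derivativeB; apply: has_derivativeZ; [exact: has_derivative_id|exact: has_derivative_Sexp].
  apply: has_derivative_eq (has_derivativeM (has_derivative_comp dE (is_derive_cexp _)) (has_derivative_div (dv t) (du t) u0)) _ _ => //.
  rewrite /D {1}/h.
  have -> : cexp t * V1 t * u t - v t * (cexp t * U1 t) = - (cexp t * W).
    by rewrite -(WE t); ring.
  have -> : cexp (m%:R / 2 * t) * W / Uh t ^+ 2 =
     cexp ((ru - rv) * t - 2 * Sexp b a t) * (cexp t * W / u t ^+ 2).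
    rewrite uE; have -> : (ru - rv) * t - 2 * Sexp b a t = (m%:R / 2 * t) + (ru * t + ru * t) - t - (Sexp b a t + Sexp b a t).
      by rewrite rE; field.
    have gen (A B T S : CC R) : cexp (A + (B + B) - T - (S + S)) =
        cexp A * cexp B ^+ 2 / cexp T * cexp (- S) ^+ 2.
      by rewrite opprD !cexpD cexpN !expr2.
    rewrite gen; have := cexp_neq0 t; have := cexp_neq0 (ru * t); have := cexp_neq0 (- Sexp b a t).
    by move=> e1 e2 e3; field; rewrite U0 e1 e2 e3.
  by ring.
- near=> s; rewrite expR_gt0 /= -(expR0 R) ler_expR oppr_le0.
  rewrite mulr_ge0 ?divr_ge0 ?ler0n //; near: s; exact: nbhs_pinfty_ge.
have k0 : (fun s => rc (k s)) @ +oo --> (0 : CC R).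
  by apply: (@cvg_rc R _ _ _ _ 0); apply: cvg_expRNM; rewrite divr_gt0.
have H : (fun s => (rc (k s) * (ru - rv) + (- 2) * (rc (k s) * dSexp a (rc s))) * h (rc s)
     + (- W) / (Uh (rc s) * Uh (rc s))) @ +oo --> (0 * (ru - rv) + (- 2) * 1) * C + - W.
  apply: cvg_add.
    apply: (cvg_mul _ h1); apply: cvg_add; first exact: (cvg_mul k0 (cvg_cst _)).
    apply: (cvg_mul (cvg_cst _)).
    rewrite (_ : (fun s => _) = (fun s => cexp (- (m%:R / 2 * rc s)) * dSexp a (rc s))).
      exact: cvg_dSexp.
    by apply/funext => s; rewrite kE.
  have U2 : (fun s => Uh (rc s) * Uh (rc s)) @ +oo --> (1 * 1 : CC R) by exact: (cvg_mul Uh1 Uh1).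
  rewrite mulr1 in U2.
  exact: (cvg_div1 (cvg_cst _) U2).
rewrite mul0r add0r mulr1 in H.
rewrite (_ : (fun s => _) = (fun s => (rc (k s) * (ru - rv) + (- 2) * (rc (k s) * dSexp a (rc s))) * h (rc s)
     + (- W) / (Uh (rc s) * Uh (rc s)))); first exact: H.
apply/funext => s; rewrite /D.
have E : rc (k s) * cexp (m%:R / 2 * rc s) = 1 by rewrite kE -cexpD addNr cexp0.
have -> : - W / (Uh (rc s) * Uh (rc s)) = - (rc (k s) * cexp (m%:R / 2 * rc s)) * W / Uh (rc s) ^+ 2.
  by rewrite E mulN1r expr2.
by ring.
Unshelve. all: by end_near. Qed.

End AtInfinity.

(** * Connection coefficients *)

Lemma det_wronskian (K : comPzRingType) (x y x' y' u v u1 v1 : K) :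
  (x * y' - y * x') * (u * v1 - u1 * v) =
  (x * u + y * v) * (x' * u1 + y' * v1) - (x * u1 + y * v1) * (x' * u + y' * v).
Proof. ring. Qed.

Section Connection.
Variables (R : realType) (m : nat) (m_gt0 : (0 < m)%N).
Variable b : 'rV[CC R]_m -> nat -> CC R.
Hypothesis hb : forall a : 'rV[CC R]_m, sqrt_expansion a (b a).
Variable Phi0 : 'rV[CC R]_m -> CC R -> CC R.
Hypothesis hPhi0 : canonical_at_infinity b Phi0.
Variables (f1 f2 : 'rV[CC R]_m.-1 -> CC R -> CC R -> CC R).
Variable (lambda : 'rV[CC R]_m.-1 -> CC R -> CC R).
Hypothesis hf : fundamental_system_at_origin f1 f2 lambda.
Variables (L0 Lt0 : 'rV[CC R]_m.-1 -> CC R -> CC R).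
Hypothesis hL : connection_coefs Phi0 f1 f2 L0 Lt0.
Variables (a' : 'rV[CC R]_m.-1) (p : CC R).
Hypothesis hp : ~ is_integer p \/ is_pos_natural p.

Local Notation ak k := (dilate (omega m k%:R) a').

(** The coefficients X_k and Y_k of the rotated Phi_(-1) on (f1, f2). *)
Definition f1_coef (k : nat) : CC R := L0 (ak k) p * omega m (k%:R * sp p) +
  Lt0 (ak k) p * omega m (k%:R * sp (- p)) * (lambda a' p * turn m k%:R).

Definition f2_coef (k : nat) : CC R := Lt0 (ak k) p * omega m (k%:R * sp (- p)).

Local Notation X := f1_coef.
Local Notation Y := f2_coef.

Lemma connection_turn (k : nat) (t : CC R) :
  Phi Phi0 (-1) (param (ak k) p) (t + turn m k%:R) = X k * f1 a' p t + Y k * f2 a' p t.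
Proof.
rewrite hL; last exact: not_pos_natural_opp.
rewrite (f1_turn m_gt0 hf) // (f2_turn m_gt0 hf) // /f1_coef /f2_coef; ring.
Qed.

Lemma param_ak k : param (ak k) p = dilate (omega m k%:R) (param a' p).
Proof. by rewrite dilate_param // omega_nat_root. Qed.

Lemma PhiN1E (a : 'rV[CC R]_m) (t : CC R) :
  Phi Phi0 (-1) a t = Phi0 (dilate (omega m (-1)) a) (t + turn m (-1)).
Proof. by []. Qed.

(** One step further Phi_(-1) becomes Phi_0, so consecutive rotations of
    Phi_(-1) are neighbouring solutions at infinity. *)
Lemma PhiN1_succ (k : nat) (t : CC R) :
  Phi Phi0 (-1) (param (ak k.+1) p) (t + turn m k.+1%:R) = Phi0 (param (ak k) p) (t + turn m k%:R).
Proof.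
have kE : -1 + k.+1%:R = k%:R :> CC R by rewrite -natr1 addrC addrK.
have E1 : dilate (omega m (-1)) (param (ak k.+1) p) = param (ak k) p.
  by rewrite (dilate_param _ _ (omegaN1_root R m_gt0)) dilateM -omegaD kE.
have E2 : t + turn m k.+1%:R + turn m (-1) = t + turn m k%:R.
  by rewrite -kE turnD [turn m (-1) + _]addrC addrA.
exact: (etrans (PhiN1E _ _) (congr2 Phi0 E1 E2)).
Qed.

(** The Wronskian of V_k and V_(k+1), computed at the origin and at
    infinity. *)
Lemma connection_det (k : nat) :
  (X k * Y k.+1 - Y k * X k.+1) * - p =
  2 * omega m (k%:R + rexp b (dilate (omega m k%:R) (param a' p)) - 1).
Proof.
pose c : CC R := turn m k%:R; set A := dilate (omega m k%:R) (param a' p).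
have np := not_pos_natural_opp hp.
have s1 := f1_solves hf a' np; have s2 := f2_solves hf a' np.
have wX := omega_nat_root R k m_gt0.
have [solPhi _ _] := hPhi0.
have su := solution_solves (solPhi A).
have sv := @solves_turn R m A (turn m (-1)) _ _ (omegaN1_root R m_gt0)
  (solution_solves (solPhi (dilate (omega m (-1)) A))).
have W := stokes_wronskian m_gt0 hb hPhi0 su sv.
have sG := @solves_turn R m (param a' p) c _ _ wX su.
have sF := @solves_turn R m (param a' p) c _ _ wX sv.
have EF : (fun t => Phi0 (dilate (omega m (-1)) A) (t + c + turn m (-1))) =
   (fun t => X k * f1 a' p t + Y k * f2 a' p t).
  by apply/funext => t; rewrite -connection_turn PhiN1E param_ak.
have EG : (fun t => Phi0 A (t + c)) = (fun t => X k.+1 * f1 a' p t + Y k.+1 * f2 a' p t).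
  by apply/funext => t; rewrite -connection_turn PhiN1_succ param_ak.
have sF' := solves_lin (X k) (Y k) s1 s2; have sG' := solves_lin (X k.+1) (Y k.+1) s1 s2.
rewrite EF in sF; rewrite EG in sG.
have F1 := congr1 (fun g => g 0) (solves_unique sF sF').
have G1 := congr1 (fun g => g 0) (solves_unique sG sG').
have F0 := congr1 (fun g => g 0) EF; have G0 := congr1 (fun g => g 0) EG.
rewrite /= in F1 G1 F0 G0.
rewrite -(wronskian_fundamental a' hf hp 0).
transitivity ((X k * f1 a' p 0 + Y k * f2 a' p 0) * (X k.+1 * dx (f1 a' p) 0 + Y k.+1 * dx (f2 a' p) 0)
  - (X k * dx (f1 a' p) 0 + Y k * dx (f2 a' p) 0) * (X k.+1 * f1 a' p 0 + Y k.+1 * f2 a' p 0)).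
  exact: det_wronskian.
rewrite -F0 -G0 -F1 -G1.
transitivity (omega m k%:R * (2 * omega m (rexp b A - 1))); last first.
  by rewrite -[k%:R + _ - _]addrA (omegaD m k%:R) mulrCA.
rewrite -(W (0 + c)).
have gen (e x y z u : CC R) : x * (e * y) - e * z * u = e * (x * y - z * u) by ring.
exact: gen.
Qed.

Hypothesis nz : forall k : nat, (k < m)%N -> Lt0 (ak k) p != 0.

Lemma Lt0_neq0 (k : nat) : (k <= m)%N -> Lt0 (ak k) p != 0.
Proof.
rewrite leq_eqVlt => /orP[/eqP ->|]; last exact: nz.
have -> : omega m m%:R = omega m 0%:R :> CC R by rewrite (omega_m R m_gt0) mulr0n omega0.
exact: nz.
Qed.

Let r (k : nat) := rexp b (dilate (omega m k%:R) (param a' p)).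

Lemma coef_ratio_step (k : nat) : (k < m)%N ->
  X k.+1 / Y k.+1 - X k / Y k =
  2 / p * omega m (- (3 / 2) - p / 2) *
    (omega m (r k + k.+1%:R * p) / (Lt0 (ak k) p * Lt0 (ak k.+1) p)).
Proof.
move=> km; have D := connection_det k; rewrite -/(r k) in D.
have p0 : p != 0 by rewrite -oppr_eq0; exact: opp_p_neq0.
have l0 := Lt0_neq0 (ltnW km); have l1 := Lt0_neq0 km.
have o0 := omega_neq0 m (k%:R * sp (- p)); have o1 := omega_neq0 m (k.+1%:R * sp (- p)).
have -> : X k.+1 / Y k.+1 - X k / Y k = ((X k * Y k.+1 - Y k * X k.+1) * - p) / (p * (Y k * Y k.+1)).
  have y0 : Y k != 0 := mulf_neq0 l0 o0.
  have y1 : Y k.+1 != 0 := mulf_neq0 l1 o1.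
  by move: (X k) (Y k) (X k.+1) (Y k.+1) y0 y1 => x y x' y' y0 y1; field; rewrite p0 y0 y1.
rewrite D /f2_coef.
(* - 3/2 - p/2 collects the exponents: k s(-p) + (k + 1) s(-p) equals
   (2 k + 1) (1 - p) / 2 *)
have E : omega m (k%:R + r k - 1) = omega m (- (3 / 2) - p / 2) * omega m (r k + k.+1%:R * p) *
    (omega m (k%:R * sp (- p)) * omega m (k.+1%:R * sp (- p))).
  by rewrite -!omegaD; congr (omega m _); rewrite -natr1 /sp; field.
rewrite E.
have gen (q l l' x y v z : CC R) : q != 0 -> l != 0 -> l' != 0 -> x != 0 -> y != 0 ->
    2 * (v * z * (x * y)) / (q * (l * x * (l' * y))) = 2 / q * v * (z / (l * l')).
  by move=> *; field; do ?[apply/andP; split].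
exact: gen.
Qed.

(** After a full turn the coefficients return to L_0 and Lt_0, up to the
    monodromy of f1 and f2. *)
Lemma coef_ratio_telescope :
  L0 a' p / Lt0 a' p * omega m (m%:R * p) + lambda a' p * (2 * Ci R * rc pi) - L0 a' p / Lt0 a' p =
  2 / p * omega m (- (3 / 2) - p / 2) *
    \sum_(0 <= k < m) omega m (r k + k.+1%:R * p) / (Lt0 (ak k) p * Lt0 (ak k.+1) p).
Proof.
have l0 := nz m_gt0; rewrite omega0 dilate1 in l0.
have := telescope_sumr (fun k => X k / Y k) (leq0n m).
rewrite (eq_big_nat _ _ (fun k (km : (0 <= k < m)%N) => coef_ratio_step (andP km).2)).
rewrite -big_distrr /= => ->; rewrite /f1_coef /f2_coef omega_m // dilate1 turn_m // omega0 dilate1.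
rewrite !mul0r omega0 !mulr1 /turn mulr0 mul0r !mulr0 addr0.
congr (_ - _).
have -> : omega m (m%:R * sp p) = omega m (m%:R * p) * omega m (m%:R * sp (- p)).
  by rewrite -omegaD; congr (omega m _); rewrite /sp; field.
have o0 := omega_neq0 m (m%:R * sp (- p)).
by field; rewrite l0 o0.
Qed.

End Connection.

Theorem theorem6p5 (R : realType) (m : nat) (m_ge1 : (1 <= m)%N)
    (b : 'rV[CC R]_m -> nat -> CC R)
    (hb : forall a : 'rV[CC R]_m, sqrt_expansion a (b a))
    (Phi0 : 'rV[CC R]_m -> CC R -> CC R)
    (hPhi0 : canonical_at_infinity b Phi0)
    (f1 f2 : 'rV[CC R]_m.-1 -> CC R -> CC R -> CC R)
    (lambda : 'rV[CC R]_m.-1 -> CC R -> CC R)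
    (hf : fundamental_system_at_origin f1 f2 lambda)
    (L0 Lt0 : 'rV[CC R]_m.-1 -> CC R -> CC R)
    (hL : connection_coefs Phi0 f1 f2 L0 Lt0)
    (a' : 'rV[CC R]_m.-1) (p : CC R) :
  (~ is_integer p ->
   (forall k : nat, (k < m)%N -> Lt0 (dilate (omega m k%:R) a') p != 0) ->
   L0 a' p / Lt0 a' p =
     - Ci R * (omega m (- (3 / 2)) * omega m (- ((m%:R + 1) * (p / 2)))
               / (p * csin (rc pi * p)))
     * \sum_(0 <= k < m)
         omega m (rexp b (dilate (omega m k%:R) (param a' p)) + (k%:R + 1) * p)
         / (Lt0 (dilate (omega m k%:R) a') p
            * Lt0 (dilate (omega m (k%:R + 1)) a') p))
  /\
  (is_pos_natural p ->
   (forall k : nat, (k < m)%N -> Lt0 (dilate (omega m k%:R) a') p != 0) ->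
   Ci R * rc pi * p * omega m (3 / 2 + p / 2) * lambda a' p =
     \sum_(0 <= k < m)
       omega m (rexp b (dilate (omega m k%:R) (param a' p)) + (k%:R + 1) * p)
       / (Lt0 (dilate (omega m k%:R) a') p
          * Lt0 (dilate (omega m (k%:R + 1)) a') p)).
Proof.
under [X in (_ -> _ -> _ = _ * X) /\ _]eq_bigr do rewrite natr1.
under [X in _ /\ (_ -> _ -> _ = X)]eq_bigr do rewrite natr1.
split=> hp nz.
  have := coef_ratio_telescope m_ge1 hb hPhi0 hf hL (or_introl hp) nz.
  set Sg := \sum_(0 <= k < m) _; rewrite (nonint_lambda0 hf _ hp) mul0r addr0.
  set x := _ / Lt0 a' p => T.
  (* E = e^(i pi p): the monodromy factor is E^2, and sin (pi p) and the power
     of omega that contains m are expressed with E as well *)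
  pose E := cexp (Ci R * rc pi * p).
  have E0 : E != 0 by exact: cexp_neq0.
  have EE : omega m (m%:R * p) = E ^+ 2.
    by rewrite omega_mM // -cexpMn; congr cexp; ring.
  have E1 : E ^+ 2 - 1 != 0.
    rewrite subr_eq0; apply/eqP => E1; apply: hp; apply: cexp_2ipi_eq1.
    by rewrite -[RHS]E1 /E -cexpMn; congr cexp; ring.
  have p0 : p != 0 by rewrite -oppr_eq0; exact: (opp_p_neq0 (or_introl hp)).
  have sE : csin (rc pi * p) = (E - E^-1) / (2 * Ci R).
    by rewrite /csin mulrA cexpN.
  have wE : omega m (- ((m%:R + 1) * (p / 2))) = omega m (- (p / 2)) / E.
    have -> : - ((m%:R + 1) * (p / 2)) = - (p / 2) + m%:R * (- (p / 2)) by ring.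
    by rewrite omegaD omega_mM // -cexpN; congr (_ * cexp _); field.
  have xE : x = 2 / p * omega m (- (3 / 2) - p / 2) * Sg / (E ^+ 2 - 1).
    by rewrite -T EE; field.
  rewrite xE sE wE (omegaD m (- (3 / 2))).
  have I2 := CiM R; have I0 := Ci_neq0 R.
  move: (omega m (- (3 / 2))) (omega m (- (p / 2))) => u v.
  have -> : E - E^-1 = (E ^+ 2 - 1) / E by field.
  set F := E ^+ 2 - 1 in E1 *.
  transitivity (- (Ci R * Ci R) * (2 / p * (u * v) * Sg / F)); first by rewrite I2 opprK mul1r.
  by field; rewrite p0 E1 E0 I0.
have := coef_ratio_telescope m_ge1 hb hPhi0 hf hL (or_intror hp) nz.
set Sg := \sum_(0 <= k < m) _.
have -> : omega m (m%:R * p) = 1.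
  by have [n _ ->] := hp; rewrite omega_mM // mulrC cexpMn cexp_2ipi expr1n.
rewrite mulr1 [X in X - _]addrC addrK => T.
have p0 : p != 0 by rewrite -oppr_eq0; exact: (opp_p_neq0 (or_intror hp)).
have wE : omega m (- (3 / 2) - p / 2) = (omega m (3 / 2 + p / 2))^-1.
  by rewrite -omegaN opprD.
have w0 := omega_neq0 m (3 / 2 + p / 2).
rewrite wE in T; move: (omega m (3 / 2 + p / 2)) w0 T => v v0 T.
transitivity (p / 2 * v * (lambda a' p * (2 * Ci R * rc pi))); first by field.
by rewrite T; field; rewrite p0 v0.
Qed.
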